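(* Let $\mathcal{M}$ and $\mathcal{N}$ be countable recursively saturated models of $\mathrm{ZF}$, and let $\mathcal{S}$ be a common rank-initial $\omega$-topless substructure of $\mathcal{M}$ and $\mathcal{N}$. Let $m_0 \in \mathcal{M}$ and let $n_0 \in \mathcal{N}$. The following are equivalent: (a) There is an isomorphism $i : \mathcal{M} \rightarrow \mathcal{N}$, fixing $\mathcal{S}$ pointwise, such that $i(m_0) = n_0$. (b) $\mathrm{SSy}_\mathcal{S}(\mathcal{M}) = \mathrm{SSy}_\mathcal{S}(\mathcal{N})$ and $\mathrm{Th}_\mathcal{S}((\mathcal{M}, m_0)) = \mathrm{Th}_\mathcal{S}((\mathcal{N}, n_0))$.
   Context: Models are structures for $\mathcal{L}^0$, the first-order language with the binary symbol $\in$. A model $\mathcal{M}$ is recursively saturated if it realizes every type $p(\vec x,\vec b)$ over $\mathcal{M}$, with a finite tuple of parameters $\vec b\in\mathcal{M}$, such that $\{\phi(\vec x,\vec y)\mid\phi(\vec x,\vec b)\in p\}$ is (via Gödel numbering) a recursive set of $\mathcal{L}^0$-formulae. A substructure $\mathcal{S}$ of $\mathcal{N}$ is rank-initial if whenever $s\in\mathcal{S}$, $n\in\mathcal{N}$ and $\mathcal{N}\models\mathrm{rank}(n)\le\mathrm{rank}(s)$, then $n\in\mathcal{S}$. $\mathcal{S}$ is bounded in $\mathcal{N}$ if there is an ordinal $\alpha$ of $\mathcal{N}$ such that every element of $\mathcal{S}$ has $\mathcal{N}$-rank less than $\alpha$. $\mathcal{S}$ is $\omega$-topless in $\mathcal{N}$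 if it is bounded and for all $f\in\mathcal{N}$ and ordinals $\alpha,\beta$ of $\mathcal{N}$ such that $\mathcal{N}\models f:\alpha\to\beta$, every standard natural number of $\mathcal{N}$ is an $\mathcal{N}$-element of $\alpha$, and $f^\mathcal{N}(k)\in\mathrm{Ord}^\mathcal{N}\setminus\mathcal{S}$ for all standard $k<\omega$, there is $\nu\in\mathrm{Ord}^\mathcal{N}\setminus\mathcal{S}$ such that $\nu<^\mathcal{N}f^\mathcal{N}(k)$ for all standard $k<\omega$. (Here $\mathrm{Ord}^\mathcal{N}$ is the class of ordinals of $\mathcal{N}$, and standard natural numbers are identified with their counterparts in $\mathcal{N}$.) A common such substructure $\mathcal{S}$ is a substructure of both $\mathcal{M}$ and $\mathcal{N}$ that has the property in both. $\mathrm{SSy}_\mathcal{S}(\mathcal{M})$ is the structure $(\mathcal{S},\mathrm{Cod}_\mathcal{S}(\mathcal{M}))$, where $\mathrm{Cod}_\mathcal{S}(\mathcal{M})$ is the set of subsets of $\mathcal{S}$ of the form $\{x\in\mathcal{S}\mid\mathcal{M}\models x\in c\}$ with $c\in\mathcal{M}$. $\mathrm{Th}_\mathcal{S}((\mathcal{M},m_0))$ is the set of all sentences with parameters $\vec s$ from $\mathcal{S}$, in the language $\mathcal{L}^0$ expanded by a constant symbol interpreted by $m_0$, that are true in $(\mathcal{M},m_0)$; in $(\mathcal{N},n_0)$ the same constant is interpreted by $n_0$. *)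

(* Defs.v *)
From mathcomp Require Import all_boot.
From mathcomp Require Import boolp classical_sets functions cardinality.

Set Implicit Arguments.
Unset Strict Implicit.
Unset Printing Implicit Defensive.

Local Open Scope classical_set_scope.

Record structure := Structure {
  carrier :> Type;
  isin : carrier -> carrier -> Prop }.

Notation "x \In y" := (isin x y) (at level 70, no associativity).

Inductive term (C : Type) (n : nat) :=
| Var of 'I_n
| Cst of C.

(* [form C n]: first-order formulas over membership and equality, with constant
   symbols from [C] and free variables among n. Variables are de Bruijn
   indices: [All] binds variable 0 and shifts the others. *)
Inductive form (C : Type) (n : nat) :=
| Bot
| Mem of term C n & term C n
| Eq of term C n & term C n
| Imp of form C n & form C n
| All of form C n.+1.

Arguments Bot {C n}.

Notation L0 := (form void).

Section Satisfaction.
Variables (C : Type) (M : structure) (I : C -> M).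

Definition eval n (v : n.-tuple M) (t : term C n) : M :=
  match t with Var i => tnth v i | Cst c => I c end.

Fixpoint sat n (phi : form C n) : n.-tuple M -> Prop :=
  match phi with
  | Bot => fun=> False
  | Mem t u => fun v => eval v t \In eval v u
  | Eq t u => fun v => eval v t = eval v u
  | Imp p q => fun v => sat p v -> sat q v
  | All p => fun v => forall a : M, sat p [tuple of a :: v]
  end.

End Satisfaction.

Definition sat0 (M : structure) n (phi : L0 n) (v : n.-tuple M) : Prop :=
  sat (of_void M) phi v.

(* The smallest class of total functions on the naturals containing zero,
   successor and projections, and closed under composition, primitive recursion
   and minimization of regular functions. *)
Inductive recursive : forall n, (n.-tuple nat -> nat) -> Prop :=
| rec_zero : recursive (fun _ : 0.-tuple nat => 0)
| rec_succ : recursive (fun v : 1.-tuple nat => (thead v).+1)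
| rec_proj n (i : 'I_n) : recursive (fun v : n.-tuple nat => tnth v i)
| rec_comp n m (f : m.-tuple nat -> nat) (g : 'I_m -> n.-tuple nat -> nat)
    (h : n.-tuple nat -> nat) :
    recursive f -> (forall i, recursive (g i)) ->
    (forall v, h v = f [tuple g i v | i < m]) ->
    recursive h
| rec_prim n (f : n.-tuple nat -> nat) (g : n.+2.-tuple nat -> nat)
    (h : n.+1.-tuple nat -> nat) :
    recursive f -> recursive g ->
    (forall v : n.-tuple nat, h [tuple of 0 :: v] = f v) ->
    (forall k (v : n.-tuple nat),
      h [tuple of k.+1 :: v] = g [tuple of k :: h [tuple of k :: v] :: v]) ->
    recursive h
| rec_mu n (f : n.+1.-tuple nat -> nat) (h : n.-tuple nat -> nat) :
    recursive f ->
    (forall v : n.-tuple nat, f [tuple of h v :: v] = 0) ->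
    (forall (v : n.-tuple nat) k, k < h v -> f [tuple of k :: v] <> 0) ->
    recursive h.

Definition recursive_set (A : set nat) : Prop :=
  recursive (fun v : 1.-tuple nat => nat_of_bool `[< A (thead v) >]).

(* Cantor's pairing function: (x + y)(x + y + 1)/2 + y *)
Definition cpair (x y : nat) : nat := 'C((x + y).+1, 2) + y.

Definition gterm n (t : term void n) : nat :=
  match t with Var i => i | Cst c => of_void nat c end.

Fixpoint godel n (phi : L0 n) : nat :=
  match phi with
  | Bot => cpair 0 0
  | Mem t u => cpair 1 (cpair (gterm t) (gterm u))
  | Eq t u => cpair 2 (cpair (gterm t) (gterm u))
  | Imp p q => cpair 3 (cpair (godel p) (godel q))
  | All p => cpair 4 (godel p)
  end.

Lemma cpair_inj x y x' y' : cpair x y = cpair x' y' -> x = x' /\ y = y'.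
Proof.
have mono a b c d : a + b < c + d -> cpair a b < cpair c d.
  move=> lt_abcd; rewrite /cpair.
  have h : 'C((a + b).+2, 2) <= 'C((c + d).+1, 2) by apply: leq_bin2l.
  apply: leq_trans (leq_addr _ _); apply: leq_trans h.
  by rewrite [in X in _ < X]binS bin1 -addnS leq_add2l ltnS leq_addl.
move=> e; have es : x + y = x' + y'.
  by case: (ltngtP (x + y) (x' + y')) => // /mono; rewrite e ltnn.
have ey : y = y' by move: e; rewrite /cpair es => /addnI.
by split=> //; move: es; rewrite ey => /addIn.
Qed.

Lemma gterm_inj n : injective (@gterm n).
Proof. by case=> [i|[]] [j|[]] /= /val_inj ->. Qed.

Lemma godel_inj n : injective (@godel n).
Proof.
move=> phi; elim: phi => {n} [n|n t u|n t u|n p IHp q IHq|n p IHp].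
- by case=> [|t' u'|t' u'|p' q'|p'] /cpair_inj[].
- by case=> [|t' u'|t' u'|p' q'|p'] /cpair_inj[] // _
    /cpair_inj[/gterm_inj -> /gterm_inj ->].
- by case=> [|t' u'|t' u'|p' q'|p'] /cpair_inj[] // _
    /cpair_inj[/gterm_inj -> /gterm_inj ->].
- by case=> [|t' u'|t' u'|p' q'|p'] /cpair_inj[] // _ /cpair_inj[/IHp -> /IHq ->].
- by case=> [|t' u'|t' u'|p' q'|p'] /cpair_inj[] // _ /IHp ->.
Qed.

(* The type is p(x, b) = {phi(x, b) | phi \in Phi}: variables 0, ..., n-1 stand
   for x, and n, ..., n+m-1 for the parameters. *)
Definition finitely_realized (M : structure) n m (Phi : set (L0 (n + m)))
    (b : m.-tuple M) : Prop :=
  forall F : set (L0 (n + m)), finite_set F -> F `<=` Phi ->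
    exists x : n.-tuple M, forall phi, F phi -> sat0 phi [tuple of x ++ b].

Definition realized (M : structure) n m (Phi : set (L0 (n + m)))
    (b : m.-tuple M) : Prop :=
  exists x : n.-tuple M, forall phi, Phi phi -> sat0 phi [tuple of x ++ b].

Definition recursively_saturated (M : structure) : Prop :=
  forall n m (Phi : set (L0 (n + m))) (b : m.-tuple M),
    recursive_set (@godel (n + m) @` Phi) ->
    finitely_realized Phi b -> realized Phi b.

Section SetTheory.
Variable M : structure.
Implicit Types a b c f p s t u v w x y z alpha beta mu nu : M.

Definition is_empty x := forall y, ~ y \In x.
Definition is_subset x y := forall z, z \In x -> z \In y.
Definition is_succ y x := forall z, z \In y <-> z \In x \/ z = x.
Definition is_upair z x y := forall w, w \In z <-> w = x \/ w = y.

(* p is the Kuratowski pair {{x}, {x, y}} *)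
Definition is_opair p x y :=
  forall z, z \In p <-> is_upair z x x \/ is_upair z x y.

Record ZF : Prop := {
  ZF_extensionality : forall x y, (forall z, z \In x <-> z \In y) -> x = y;
  ZF_foundation : forall x, (exists y, y \In x) ->
    exists2 y, y \In x & forall z, z \In x -> ~ z \In y;
  ZF_pairing : forall x y, exists z, is_upair z x y;
  ZF_union : forall x, exists u, forall z,
    z \In u <-> exists2 y, y \In x & z \In y;
  ZF_powerset : forall x, exists p, forall y, y \In p <-> is_subset y x;
  ZF_infinity : exists w, (exists2 e, e \In w & is_empty e) /\
    forall x, x \In w -> exists2 y, y \In w & is_succ y x;
  ZF_separation : forall n (phi : L0 n.+1) (v : n.-tuple M) a,
    exists b, forall x, x \In b <-> x \In a /\ sat0 phi [tuple of x :: v];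
  ZF_replacement : forall n (phi : L0 n.+2) (v : n.-tuple M) a,
    (forall x y y', x \In a -> sat0 phi [tuple of x :: y :: v] ->
       sat0 phi [tuple of x :: y' :: v] -> y = y') ->
    exists b, forall y,
      y \In b <-> exists2 x, x \In a & sat0 phi [tuple of x :: y :: v] }.

Definition transitive_set x := forall y, y \In x -> is_subset y x.

Definition wellordered_by_mem x :=
  [/\ forall y, y \In x -> ~ y \In y,
      forall y z w, y \In x -> z \In x -> w \In x ->
        y \In z -> z \In w -> y \In w,
      forall y z, y \In x -> z \In x -> [\/ y \In z, y = z | z \In y] &
      forall u, is_subset u x -> (exists y, y \In u) ->
        exists2 m, m \In u & forall y, y \In u -> m = y \/ m \In y].

Definition ordinal_of x := transitive_set x /\ wellordered_by_mem x.

Definition app f x y := exists2 p, is_opair p x y & p \In f.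

Definition is_fun f a b :=
  (forall p, p \In f -> exists x y, [/\ x \In a, y \In b & is_opair p x y]) /\
  (forall x, x \In a -> exists! y, app f x y).

(* rank(y) = sup {rank(z) + 1 | z \in y}, by recursion on a transitive set t
   containing x *)
Definition has_rank x alpha :=
  exists t b f, [/\ transitive_set t, x \In t, is_fun f t b,
    forall y u, y \In t -> app f y u ->
      forall w, w \In u <->
        exists z v, [/\ z \In y, app f z v & w \In v \/ w = v] &
    app f x alpha].

Definition rank_le x y :=
  exists alpha beta, [/\ has_rank x alpha, has_rank y beta &
                         alpha \In beta \/ alpha = beta].

Definition rank_lt_ord x alpha := exists2 beta, has_rank x beta & beta \In alpha.

(* x is the counterpart in M of the standard natural number k *)
Fixpoint numeral (k : nat) (x : M) : Prop :=
  if k is k'.+1 then exists2 y, numeral k' y & is_succ x y else is_empty x.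

Definition value_at f (k : nat) nu := exists2 x, numeral k x & app f x nu.

Definition rank_initial (S : set M) : Prop :=
  forall s x, S s -> rank_le x s -> S x.

Definition bounded (S : set M) : Prop :=
  exists2 alpha, ordinal_of alpha & forall s, S s -> rank_lt_ord s alpha.

Definition omega_topless (S : set M) : Prop :=
  bounded S /\
  forall f alpha beta, ordinal_of alpha -> ordinal_of beta ->
    is_fun f alpha beta ->
    (forall k x, numeral k x -> x \In alpha) ->
    (forall k mu, value_at f k mu -> ordinal_of mu /\ ~ S mu) ->
    exists nu, [/\ ordinal_of nu, ~ S nu &
                   forall k mu, value_at f k mu -> nu \In mu].

End SetTheory.

Definition embedding (A B : structure) (j : A -> B) : Prop :=
  injective j /\ forall x y, x \In y <-> j x \In j y.

Definition isomorphism (A B : structure) (i : A -> B) : Prop :=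
  bijective i /\ forall x y, x \In y <-> i x \In i y.

Section OverSubstructure.
(* S is a substructure of M via the inclusion map j. *)
Variables (S M : structure) (j : S -> M).

Definition Cod : set (set S) :=
  [set A | exists c : M, A = [set x : S | j x \In c]].

Definition SSy : (S -> S -> Prop) * set (set S) := (@isin S, Cod).

(* The constant [None] denotes m0, and [Some s] is the parameter s. *)
Definition Th (m0 : M) : set (form (option S) 0) :=
  [set phi | sat (oapp j m0) phi [tuple]].

End OverSubstructure.

(* Main.v *)
Require Import Defs.
From mathcomp Require Import all_boot.
From mathcomp Require Import boolp classical_sets functions cardinality.
From mathcomp Require Import zify.

Set Implicit Arguments.
Unset Strict Implicit.
Unset Printing Implicit Defensive.

Local Open Scope classical_set_scope.

(** An isomorphism that fixes S carries coded subsets of S to coded subsets of S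
    and preserves truth, which is one direction.  The converse is a back-and-forth
    argument.  Elements m of M and n of N are said to have the same type over S
    if they satisfy the same formulas with parameters in S ([same_type]); finite
    tuples are represented by iterated pairs, so single elements are enough.  The
    equality of the theories says that m0 and n0 have the same type, and the two
    models are countable, so everything rests on the extension step
    ([same_type_extend]): if m and n have the same type, then for each x in M
    there is y in N such that the pairs (m, x) and (n, y) have the same type.

    To find y, the type of (m, x) over S is first carried from M to N.  By
    recursive saturation some c in M codes this type over a whole level of M
    that includes S: the pair of k and s belongs to c if and only if the k-th
    formula holds at s and (m, x) ([coding_lemma]).  Only the trace of c on S
    matters, and as the two models code the same subsets of S, it is the trace
    of some d in N.  It remains to realize in N the type coded by d.  Since S is
    not definable in N, saturation does not apply directly.  For each standard K
    and each ordinal g of S, the first K formulas can be realized over the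
    elements of rank less than g, because this is a first-order statement about
    an element of S, which is true in M.  Hence the first K formulas can be
    realized over the elements of rank less than some ordinal outside S, which
    depends on K.  Toplessness, applied to an internal function that extends the
    sequence of these ordinals, yields one ordinal outside S that is good for
    all standard K.  It can be used as a parameter in place of S, and recursive
    saturation provides y.

    Recursive saturation is available for recursive sets of Goedel numbers.  The
    types that occur are enumerated by recursive sequences of formulas, which is
    sufficient by Craig's trick ([uniform_saturation]).  The closure properties
    of [fam] produce such sequences from the mathematical form of the
    conditions; the essential ingredients are that the sequence of all unary
    formulas ([ufam_truth]) and that of the definitions of the numerals
    ([fam_numeral]) are recursive.  The set theory needed is a theory of ranks
    that is local to the levels ([level_ex], [rank_subset_level]), from which it
    follows that S contains the numerals and is closed under pairs
    ([cut_ord_num], [cut_opair]). *)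

(** * Recursive functions *)

(** Functions of n variables are written on infinite assignments, so that a
    variable is addressed by a plain number and no tuple has to be built. *)
Definition rfun n (F : (nat -> nat) -> nat) : Prop :=
  recursive (fun v : n.-tuple nat => F (nth 0 v)).

Lemma recursive_ext n (f g : n.-tuple nat -> nat) :
  recursive f -> (forall v, g v = f v) -> recursive g.
Proof. by move=> rf e; rewrite (_ : g = f) //; apply/funext. Qed.

Lemma rfun_ext n F G : rfun n F -> (forall e, G e = F e) -> rfun n G.
Proof. by move=> rF e; apply: recursive_ext rF _ => v; rewrite e. Qed.

Lemma rfun_var n i : i < n -> rfun n (fun e => e i).
Proof.
move=> lt_in; apply: recursive_ext (rec_proj (Ordinal lt_in)) _ => v.
by rewrite (tnth_nth 0).
Qed.

Lemma rfun_const n c : rfun n (fun=> c).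
Proof.
elim: c => [|c IH].
  by apply: (@rec_comp n 0 _ (fun i v => 0)) rec_zero _ _ => // -[].
by apply: (@rec_comp n 1 _ (fun i v => c)) rec_succ _ _ => // v; rewrite /thead tnth_mktuple.
Qed.

Lemma rfun_ap1 f n F : rfun 1 (fun e => f (e 0)) -> rfun n F ->
  rfun n (fun e => f (F e)).
Proof.
move=> rf rF.
apply: (rec_comp (g := fun (i : 'I_1) v => F (nth 0 v)) rf) => // v.
by rewrite -(tnth_nth 0 _ ord0) tnth_mktuple.
Qed.
Lemma rfun_ap2 f n F G : rfun 2 (fun e => f (e 0) (e 1)) -> rfun n F -> rfun n G ->
  rfun n (fun e => f (F e) (G e)).
Proof.
move=> rf rF rG.
apply: (rec_comp (g := fun (i : 'I_2) v =>
   (if i == ord0 then F else G) (nth 0 v)) rf).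
  by move=> i; case: ifP.
by move=> v; rewrite -!(tnth_nth 0 _ ord0) -(tnth_nth 0 _ (lift ord0 ord0)) !tnth_mktuple.
Qed.
Lemma rfun_succ n F : rfun n F -> rfun n (fun e => (F e).+1).
Proof.
by apply: (rfun_ap1 (f := S)); apply: recursive_ext rec_succ _ => v; case/tupleP: v.
Qed.

Lemma rfun_rec1 (h : nat -> nat) g : rfun 2 (fun e => g (e 0) (e 1)) ->
  (forall k, h k.+1 = g k (h k)) -> rfun 1 (fun e => h (e 0)).
Proof.
move=> rg hS; apply: (rec_prim (rfun_const 0 (h 0)) rg) => [v //|k v /=].
by rewrite hS.
Qed.

Lemma rfun_rec2 (h : nat -> nat -> nat) g :
  rfun 1 (fun e => h 0 (e 0)) -> rfun 3 (fun e => g (e 0) (e 1) (e 2)) ->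
  (forall k p, h k.+1 p = g k (h k p) p) -> rfun 2 (fun e => h (e 0) (e 1)).
Proof.
move=> r0 rg hS; apply: (rec_prim r0 rg) => [v //|k v /=].
by rewrite hS.
Qed.

Lemma rfun_add n F G : rfun n F -> rfun n G -> rfun n (fun e => F e + G e).
Proof.
apply: rfun_ap2; apply: (@rfun_rec2 addn (fun _ r _ => r.+1)) => //.
- by apply: rfun_ext (@rfun_var 1 0 _) _.
- by apply/rfun_succ/rfun_var.
Qed.

Lemma rfun_mul n F G : rfun n F -> rfun n G -> rfun n (fun e => F e * G e).
Proof.
apply: rfun_ap2; apply: (@rfun_rec2 muln (fun _ r p => p + r)) => //.
- exact: rfun_const.
- by apply/rfun_add; apply: rfun_var.
Qed.

Lemma rfun_pred n F : rfun n F -> rfun n (fun e => (F e).-1).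
Proof.
apply: (rfun_ap1 (f := predn)); apply: (@rfun_rec1 _ (fun k _ => k)) => //.
exact: rfun_var.
Qed.

Lemma rfun_sub n F G : rfun n F -> rfun n G -> rfun n (fun e => F e - G e).
Proof.
move=> rF rG; apply: (rfun_ap2 (f := fun k p => p - k)) rG rF.
apply: (@rfun_rec2 (fun k p => p - k) (fun _ r _ => r.-1)).
- by apply: rfun_ext (@rfun_var 1 0 _) _ => // e; rewrite subn0.
- by apply/rfun_pred/rfun_var.
- by move=> k p; rewrite subnS.
Qed.

Lemma rfun_if0 n B F G : rfun n B -> rfun n F -> rfun n G ->
  rfun n (fun e => if B e == 0 then F e else G e).
Proof.
move=> rB rF rG.
(* With truncated subtraction, 1 - b is the indicator of b = 0. *)
have r1 := rfun_const n 1.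
apply: rfun_ext (rfun_add (rfun_mul (rfun_sub r1 rB) rF)
  (rfun_mul (rfun_sub r1 (rfun_sub r1 rB)) rG)) _ => e.
by case: (B e) => [|b] /=; rewrite ?subn0 ?mul1n ?mul0n ?addn0 //; lia.
Qed.

Lemma rfun_leq n F G : rfun n F -> rfun n G -> rfun n (fun e => nat_of_bool (F e <= G e)).
Proof.
move=> rF rG; apply: rfun_ext (rfun_if0 (rfun_sub rF rG)
  (rfun_const n 1) (rfun_const n 0)) _ => e.
by rewrite /leq; case: ifP.
Qed.

Lemma rfun_if n (B : (nat -> nat) -> bool) F G :
  rfun n (fun e => nat_of_bool (B e)) -> rfun n F -> rfun n G ->
  rfun n (fun e => if B e then F e else G e).
Proof.
move=> rB rF rG; apply: rfun_ext (rfun_if0 rB rG rF) _ => e.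
by case: (B e).
Qed.

Lemma rfun_eq n F G : rfun n F -> rfun n G -> rfun n (fun e => nat_of_bool (F e == G e)).
Proof.
move=> rF rG; apply: rfun_ext (rfun_mul (rfun_leq rF rG) (rfun_leq rG rF)) _ => e.
by rewrite mulnb eqn_leq.
Qed.

Lemma rfun_max n F G : rfun n F -> rfun n G -> rfun n (fun e => maxn (F e) (G e)).
Proof.
by move=> rF rG; apply: rfun_ext (rfun_if (rfun_leq rF rG) rG rF) _ => e; case: leqP.
Qed.

Definition tri s := 'C(s.+1, 2).
Lemma triS s : tri s.+1 = tri s + s.+1.
Proof. by rewrite /tri binS bin1. Qed.

Lemma rfun_tri n F : rfun n F -> rfun n (fun e => tri (F e)).
Proof.
apply: (rfun_ap1 (f := tri)); apply: (@rfun_rec1 _ (fun k r => r + k.+1)).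
- by apply/rfun_add/rfun_succ; apply: rfun_var.
- exact: triS.
Qed.

Lemma rfun_pair n F G : rfun n F -> rfun n G -> rfun n (fun e => cpair (F e) (G e)).
Proof. by move=> rF rG; apply: rfun_add => //; apply/rfun_tri/rfun_add. Qed.

(** The index x + y of the diagonal that contains the pair coded by c.  It is
    obtained by recursion on c, counting diagonals, which makes the inverse of
    the pairing function primitive recursive without any search. *)
Fixpoint diag c := if c is c'.+1 then
  if tri (diag c').+1 <= c'.+1 then (diag c').+1 else diag c' else 0.
Definition csnd c := c - tri (diag c).
Definition cfst c := diag c - csnd c.

Lemma diagP c : tri (diag c) <= c < tri (diag c).+1.
Proof.
elim: c => [//|c /andP[IH1 IH2]] /=.
have [h|h] := boolP (tri (diag c).+1 <= c.+1); apply/andP; split;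
  move: IH1 IH2 h; rewrite !triS; lia.
Qed.

Lemma tri_mono s t : s <= t -> tri s <= tri t.
Proof. by move=> st; apply: leq_bin2l. Qed.

Lemma cpair_diag x y : diag (cpair x y) = x + y.
Proof.
have /andP[h1 h2] := diagP (cpair x y).
have k1 : tri (x + y) <= cpair x y by apply: leq_addr.
have k2 : cpair x y < tri (x + y).+1 by rewrite triS /cpair -/(tri _); lia.
apply/eqP; rewrite eqn_leq; apply/andP; split; rewrite leqNgt; apply/negP => lt.
- by have := tri_mono lt; lia.
- by have := tri_mono lt; lia.
Qed.

Lemma cpairK1 x y : cfst (cpair x y) = x.
Proof. by rewrite /cfst /csnd cpair_diag /cpair -/(tri _); lia. Qed.
Lemma cpairK2 x y : csnd (cpair x y) = y.
Proof. by rewrite /csnd cpair_diag /cpair -/(tri _); lia. Qed.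
Lemma cpair_eta c : cpair (cfst c) (csnd c) = c.
Proof.
have /andP[h1 h2] := diagP c; rewrite triS in h2.
have h3 : csnd c <= diag c by rewrite /csnd; lia.
by rewrite /cpair -/(tri _) /cfst subnK // /csnd; lia.
Qed.

Lemma leq_tri s : s <= tri s.
Proof. by elim: s => // s IH; rewrite triS; lia. Qed.
Lemma leq_cpair x y : x + y.*2 <= cpair x y.
Proof. by rewrite /cpair -/(tri _); have := leq_tri (x + y); lia. Qed.

Lemma rfun_diag n F : rfun n F -> rfun n (fun e => diag (F e)).
Proof.
apply: (rfun_ap1 (f := diag)).
apply: (@rfun_rec1 _ (fun k r => if tri r.+1 <= k.+1 then r.+1 else r)) => //.
by apply: rfun_if; rewrite ?(rfun_var, rfun_leq, rfun_tri, rfun_succ) //;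
  [apply: rfun_leq; [apply/rfun_tri/rfun_succ|apply: rfun_succ]|apply: rfun_succ|];
  apply: rfun_var.
Qed.

Lemma rfun_snd n F : rfun n F -> rfun n (fun e => csnd (F e)).
Proof. by move=> rF; apply: rfun_sub => //; apply/rfun_tri/rfun_diag. Qed.
Lemma rfun_fst n F : rfun n F -> rfun n (fun e => cfst (F e)).
Proof. by move=> rF; apply: rfun_sub; [apply: rfun_diag|apply: rfun_snd]. Qed.

(** The bound on a variable is discharged by [exact: isT]: a search through the
    hypotheses could start to compute Goedel numbers. *)
Ltac rfun_tac := repeat (cbv beta; match goal with
  | |- rfun _ (fun=> ?c) => apply: rfun_const
  | |- rfun _ (fun e => e _) => apply: rfun_var; exact: isT
  | |- rfun _ (fun e => nat_of_bool (_ <= _)) => apply: rfun_leq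
  | |- rfun _ (fun e => nat_of_bool (_ == _)) => apply: rfun_eq
  | |- rfun _ (fun e => if _ then _ else _) => apply: rfun_if
  | |- rfun _ (fun e => cpair _ _) => apply: rfun_pair
  | |- rfun _ (fun e => cfst _) => apply: rfun_fst
  | |- rfun _ (fun e => csnd _) => apply: rfun_snd
  | |- rfun _ (fun e => maxn _ _) => apply: rfun_max
  | |- rfun _ (fun e => _.-1) => apply: rfun_pred
  | |- rfun _ (fun e => _ - _) => apply: rfun_sub
  | |- rfun _ (fun e => _ + _) => apply: rfun_add
  | |- rfun _ (fun e => _ * _) => apply: rfun_mul
  | |- rfun _ (fun e => _.+1) => apply: rfun_succ
  end).

(** The values of a function below c are stored in a nested pair with the latest
    one outermost, hence the value at i sits at depth c - i - 1. *)
Definition lookup d t := cfst (iter d csnd t).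

Lemma rfun_lookup n D T : rfun n D -> rfun n T -> rfun n (fun e => lookup (D e) (T e)).
Proof.
move=> rD rT; apply: rfun_fst; apply: (rfun_ap2 (f := fun d t => iter d csnd t)) rD rT.
apply: (@rfun_rec2 (fun d t => iter d csnd t) (fun _ r _ => csnd r)) => //=; rfun_tac.
Qed.

Section CourseOfValues.
Variable G : nat -> nat -> nat.
Fixpoint table c := if c is c'.+1 then cpair (G c' (table c')) (table c') else 0.
Definition course_of_values c := G c (table c).

Lemma lookup_table c i : i < c -> lookup (c - i.+1) (table c) = course_of_values i.
Proof.
elim: c => // c IH; rewrite ltnS leq_eqVlt => /orP[/eqP->|lt_ic].
  by rewrite subnn /lookup /= cpairK1.
rewrite subSS (_ : c - i = (c - i.+1).+1); last lia.
rewrite /lookup iterSr /= cpairK2 -/(lookup _ _).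
exact: IH.
Qed.

Lemma rfun_course_of_values n F : rfun 2 (fun e => G (e 0) (e 1)) -> rfun n F ->
  rfun n (fun e => course_of_values (F e)).
Proof.
move=> rG rF; apply: (rfun_ap2 rG) => //; apply: (rfun_ap1 (f := table)) rF.
apply: (@rfun_rec1 _ (fun k r => cpair (G k r) r)) => //.
by apply: rfun_pair => //; rfun_tac.
Qed.
End CourseOfValues.

(** * Deciding which numbers are Goedel numbers *)

(** [scope c] is 0 if c is not a Goedel number, and otherwise one more than the
    least n such that c is the Goedel number of a formula in n free variables.
    Recording the least n, rather than testing a given n, is what makes
    course-of-values recursion possible: a quantifier changes the number of free
    variables, so a test at n would call a test at n + 1. *)
Definition scope_step c t :=
  let a := cfst c in let b := csnd c in
  let p := lookup (c - (cfst b).+1) t in let q := lookup (c - (csnd b).+1) t in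
  let r := lookup (c - b.+1) t in
  if a == 0 then nat_of_bool (b == 0)
  else if a <= 2 then (maxn (cfst b) (csnd b)).+2
  else if a == 3 then if p == 0 then 0 else if q == 0 then 0 else maxn p q
  else if a == 4 then if r == 0 then 0 else maxn 1 r.-1
  else 0.
Definition scope := course_of_values scope_step.

Lemma rfun_scope n F : rfun n F -> rfun n (fun e => scope (F e)).
Proof.
apply: rfun_course_of_values; rewrite /scope_step.
repeat first [progress rfun_tac | apply: rfun_lookup].
Qed.

Lemma scope_cpair a b : let s x y :=
   if a == 0 then nat_of_bool (b == 0)
  else if a <= 2 then (maxn (cfst b) (csnd b)).+2
  else if a == 3 then if x == 0 then 0 else if y == 0 then 0 else maxn x y
  else if a == 4 then if scope b == 0 then 0 else maxn 1 (scope b).-1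
  else 0 in scope (cpair a b) = s (scope (cfst b)) (scope (csnd b)).
Proof.
rewrite /= {1}/scope /course_of_values /scope_step cpairK1 cpairK2.
case: eqP => // a0; case: ifP => // a2.
have ltb : b < cpair a b by have := leq_cpair a b; lia.
have := leq_cpair (cfst b) (csnd b); rewrite cpair_eta => leb.
by rewrite !lookup_table //; lia.
Qed.

Lemma scope_godel n (phi : L0 n) : 0 < scope (godel phi) <= n.+1.
Proof.
elim: phi => {n} [n|n t u|n t u|n p IHp q IHq|n p IHp] /=; rewrite scope_cpair /=.
- by [].
- by case: t u => [i|[]] [j|[]]; rewrite cpairK1 cpairK2 /=; have := ltn_ord i;
    have := ltn_ord j; lia.
- by case: t u => [i|[]] [j|[]]; rewrite cpairK1 cpairK2 /=; have := ltn_ord i;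
    have := ltn_ord j; lia.
- rewrite cpairK1 cpairK2; case: eqP => [p0|_]; first by move: IHp; rewrite p0.
  by case: eqP => [q0|_]; [move: IHq; rewrite q0|lia].
- by case: eqP => [p0|_]; [move: IHp; rewrite p0|lia].
Qed.

Lemma scope_ex c n : 0 < scope c <= n.+1 -> exists phi : L0 n, godel phi = c.
Proof.
elim/ltn_ind: c n => c IH n; rewrite -(cpair_eta c).
move: (cfst c) (csnd c) (cpair_eta c) => a b ec; rewrite scope_cpair /=.
have leb := leq_cpair a b; rewrite ec in leb.
have := leq_cpair (cfst b) (csnd b); rewrite cpair_eta => leb2.
case: eqP => [->|a0]; first by case: eqP => // -> _; exists Bot.
case: ifP => a2.
  case/andP=> _ mb.
  have lt1 : cfst b < n by lia.
  have lt2 : csnd b < n by lia.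
  have [-> | ->] : a = 1 \/ a = 2 by lia.
  - by exists (Defs.Mem (Var void (Ordinal lt1)) (Var void (Ordinal lt2))); rewrite /= cpair_eta.
  - by exists (Defs.Eq (Var void (Ordinal lt1)) (Var void (Ordinal lt2))); rewrite /= cpair_eta.
case: eqP => [a3|a3].
  case: eqP => // p0; case: eqP => // q0 /andP[_ mx].
  have [||p ep] := IH (cfst b) _ n; try lia.
  have [||q eq] := IH (csnd b) _ n; try lia.
  by exists (Imp p q); rewrite /= ep eq cpair_eta a3.
case: eqP => // a4; case: eqP => // r0 mx.
have [||p ep] := IH b _ n.+1; try lia.
by exists (All p); rewrite /= ep a4.
Qed.

Lemma godelP c n : (exists phi : L0 n, godel phi = c) <-> 0 < scope c <= n.+1.
Proof. by split=> [[phi <-]|]; [exact: scope_godel|exact: scope_ex]. Qed.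

(** * Substitution and assignments *)

(* Prevents conversion from evaluating pairs of concrete numbers. *)
Local Opaque cpair.

Definition lift_term C n (t : term C n) : term C n.+1 :=
  match t with Var i => Var C (lift ord0 i) | Cst c => Cst n.+1 c end.

Definition subst_term C D n m (s : 'I_n -> term D m) (r : C -> term D m)
  (t : term C n) := match t with Var i => s i | Cst c => r c end.

Definition up C n m (s : 'I_n -> term C m) (i : 'I_n.+1) : term C m.+1 :=
  oapp (fun j => lift_term (s j)) (Var C ord0) (unlift ord0 i).

(** Variables and constants are replaced simultaneously, so that one operation
    serves to weaken, to instantiate variables by constants, and to trade
    constants for variables. *)
Fixpoint subst C D n (phi : form C n) :
    forall m, ('I_n -> term D m) -> (C -> term D m) -> form D m :=
  match phi with
  | Bot => fun m s r => Bot
  | Defs.Mem t u => fun m s r => Defs.Mem (subst_term s r t) (subst_term s r u)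
  | Defs.Eq t u => fun m s r => Defs.Eq (subst_term s r t) (subst_term s r u)
  | Imp p q => fun m s r => Imp (subst p s r) (subst q s r)
  | All p => fun m s r => All (subst p (up s) (fun c => lift_term (r c)))
  end.

Definition term_csts C n (t : term C n) : seq C :=
  match t with Var _ => [::] | Cst c => [:: c] end.
Fixpoint csts C n (phi : form C n) : seq C :=
  match phi with
  | Bot => [::]
  | Defs.Mem t u => term_csts t ++ term_csts u
  | Defs.Eq t u => term_csts t ++ term_csts u
  | Imp p q => csts p ++ csts q
  | All p => csts p
  end.

Lemma tnth_cons0 (T : Type) n (a : T) (v : n.-tuple T) :
  tnth [tuple of a :: v] ord0 = a.
Proof. by []. Qed.
Lemma tnth_consS (T : Type) n (a : T) (v : n.-tuple T) (i : 'I_n) :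
  tnth [tuple of a :: v] (lift ord0 i) = tnth v i.
Proof. by rewrite !(tnth_nth a). Qed.

Lemma eval_lift C (M : structure) (I : C -> M) n a (v : n.-tuple M) (t : term C n) :
  eval I [tuple of a :: v] (lift_term t) = eval I v t.
Proof. by case: t => [i|c] //=; rewrite tnth_consS. Qed.

(** Only the constants that occur in the formula matter: this is what allows a
    formula with constants to be replaced by one with finitely many parameters. *)
Lemma sat_subst C D (M : structure) (I : C -> M) (J : D -> M) n (phi : form C n) m
    (s : 'I_n -> term D m) (r : C -> term D m) (u : n.-tuple M) (v : m.-tuple M) :
  (forall i, eval J v (s i) = tnth u i) ->
  (forall c, List.In c (csts phi) -> eval J v (r c) = I c) ->
  sat J (subst phi s r) v <-> sat I phi u.
Proof.
elim: phi m s r u v => {n} [n|n t u|n t u|n p IHp q IHq|n p IHp] m s r x v hs hr //=.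
- have e (w : term C n) : (forall c, List.In c (term_csts w) -> eval J v (r c) = I c) ->
      eval J v (subst_term s r w) = eval I x w.
    by case: w => [i _|c h] /=; [exact: hs|apply: h; left].
  by rewrite !e // => c cw; apply: hr; apply/List.in_or_app; [right|left].
- have e (w : term C n) : (forall c, List.In c (term_csts w) -> eval J v (r c) = I c) ->
      eval J v (subst_term s r w) = eval I x w.
    by case: w => [i _|c h] /=; [exact: hs|apply: h; left].
  by rewrite !e // => c cw; apply: hr; apply/List.in_or_app; [right|left].
- have [] := IHp m s r x v hs _.
    by move=> c cp; apply: hr; apply/List.in_or_app; left.
  have [] := IHq m s r x v hs _; last by tauto.
  by move=> c cp; apply: hr; apply/List.in_or_app; right.
- have {}IHp a : sat J (subst p (up s) (fun c => lift_term (r c))) [tuple of a :: v] <->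
      sat I p [tuple of a :: x].
    apply: IHp => [i|c cp]; last by rewrite eval_lift hr.
    rewrite /up; case: unliftP => [j ->|->] /=; first by rewrite eval_lift hs tnth_consS.
    by rewrite tnth_cons0.
  by split=> h a; apply/IHp.
Qed.

(** With 0 for each constant, the numbering extends the one of formulas without
    constants, so that the families of formulas below can be treated at once
    with and without constants. *)
Definition term_code C n (t : term C n) : nat :=
  match t with Var i => i | Cst _ => 0 end.
Fixpoint code C n (phi : form C n) : nat :=
  match phi with
  | Bot => cpair 0 0
  | Defs.Mem t u => cpair 1 (cpair (term_code t) (term_code u))
  | Defs.Eq t u => cpair 2 (cpair (term_code t) (term_code u))
  | Imp p q => cpair 3 (cpair (code p) (code q))
  | All p => cpair 4 (code p)
  end.

Lemma code_godel n (phi : L0 n) : code phi = godel phi.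
Proof.
have e m (t : term void m) : term_code t = gterm t by case: t => [|[]].
by elim: phi => {n} //= [n t u|n t u|n p -> q ->|n p ->] //; rewrite !e.
Qed.

Definition widen C n m (le_nm : n <= m) (phi : form C n) : form C m :=
  subst phi (fun i => Var C (widen_ord le_nm i)) (fun c => Cst m c).

Lemma code_subst C n m (s : 'I_n -> 'I_m) (phi : form C n) :
  (forall i, s i = i :> nat) ->
  code (subst phi (fun i => Var C (s i)) (fun c => Cst m c)) = code phi.
Proof.
have code_term k l (r : 'I_k -> term C l) (t : term C k) :
    (forall i, exists2 j, r i = Var C j & j = i :> nat) ->
    term_code (subst_term r (fun c => Cst l c) t) = term_code t.
  by case: t => [i|c] // /(_ i)[j e1 e2]; rewrite /= e1.
move=> hs; suff main (r : 'I_n -> term C m) :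
    (forall i, exists2 j, r i = Var C j & j = i :> nat) ->
    code (subst phi r (fun c => Cst m c)) = code phi.
  by apply: main => i; exists (s i).
elim: phi m r {s hs} => {n} //= [n t u|n t u|n p IHp q IHq|n p IHp] m s hs.
- by rewrite !code_term.
- by rewrite !code_term.
- by rewrite IHp // IHq.
- rewrite -(IHp _ (up s)) // => i; rewrite /up; case: unliftP => [j ->|->] /=.
    by have [l -> e] := hs j; exists (lift ord0 l) => //=; rewrite e.
  by exists ord0.
Qed.

(** Assignments are infinite sequences: a formula with n free variables reads
    the first n entries, so that weakening does not change the meaning. *)
Definition env (T : Type) n (e : nat -> T) : n.-tuple T := [tuple e i | i < n].
Definition scons (T : Type) (a : T) (e : nat -> T) (i : nat) : T :=
  if i is i'.+1 then e i' else a.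

Lemma env_scons (T : Type) n (a : T) (e : nat -> T) :
  [tuple of a :: env n e] = env n.+1 (scons a e).
Proof.
apply: eq_from_tnth => i; rewrite tnth_mktuple.
by case: (unliftP ord0 i) => [j ->|->]; rewrite ?tnth_consS ?tnth_mktuple.
Qed.

Lemma sat_widen C (M : structure) (I : C -> M) n m (le_nm : n <= m) (phi : form C n) e :
  sat I (widen le_nm phi) (env m e) <-> sat I phi (env n e).
Proof. by apply: sat_subst => // i; rewrite /= !tnth_mktuple. Qed.

(** * Definable families of predicates *)

Section Families.
Variables (C W : Type) (str : W -> structure) (I : forall w, C -> str w).
Implicit Type Q : nat -> forall w, (nat -> str w) -> Prop.

(** [fam Q] says that the predicates [Q k] are defined by formulas whose codes
    form a recursive sequence, uniformly in the structures [str w].  Two cases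
    are used: all structures at once and no constants, which gives recursive
    types and the comparison of two models; and one structure with constants for
    its elements, which gives the instances of separation and replacement.
    Constant families express plain definability. *)
Definition fam Q : Prop := exists n (phi : nat -> form C n),
  rfun 1 (fun v => code (phi (v 0))) /\
  forall k w e, sat (I w) (phi k) (env n e) <-> Q k w e.

Definition tfam (t : forall w, (nat -> str w) -> str w) : Prop :=
  (exists i, forall w e, t w e = e i) \/ (exists c, forall w e, t w e = I w c).

Lemma fam_min Q m : fam Q -> exists2 n, m <= n & exists phi : nat -> form C n,
  rfun 1 (fun v => code (phi (v 0))) /\
  forall k w e, sat (I w) (phi k) (env n e) <-> Q k w e.
Proof.
case=> n [phi [rphi h]]; exists (maxn m n); first exact: leq_maxl.
exists (fun k => widen (leq_maxr m n) (phi k)); split.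
  by apply: rfun_ext rphi _ => e; rewrite code_subst.
by move=> k w e; rewrite sat_widen.
Qed.

Lemma fam_iff Q Q' : fam Q -> (forall k w e, Q k w e <-> Q' k w e) -> fam Q'.
Proof.
case=> n [phi [r h]] hQ; exists n, phi; split=> // k w e.
by rewrite h hQ.
Qed.

Lemma fam2 Q Q' : fam Q -> fam Q' -> exists n (phi psi : nat -> form C n),
  [/\ rfun 1 (fun v => code (phi (v 0))), rfun 1 (fun v => code (psi (v 0))),
   forall k w e, sat (I w) (phi k) (env n e) <-> Q k w e &
   forall k w e, sat (I w) (psi k) (env n e) <-> Q' k w e].
Proof.
move=> [n [phi [rphi hphi]]] /(@fam_min _ n)[m le_nm [psi [rpsi hpsi]]].
exists m, (fun k => widen le_nm (phi k)), psi; split=> //.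
  by apply: rfun_ext rphi _ => e; rewrite code_subst.
by move=> k w e; rewrite sat_widen.
Qed.

Lemma fam_bot : fam (fun _ _ _ => False).
Proof. by exists 0, (fun=> Bot); split=> //; apply: rfun_const. Qed.

Lemma tfam_term t : tfam t -> exists n0, forall n, n0 <= n ->
  exists u : term C n, forall w e, eval (I w) (env n e) u = t w e.
Proof.
case=> [[i hi]|[c hc]].
  exists i.+1 => n lt_in; exists (Var C (Ordinal lt_in)) => w e.
  by rewrite /= tnth_mktuple hi.
by exists 0 => n _; exists (Cst n c) => w e; rewrite hc.
Qed.

Lemma tfam_term2 t u : tfam t -> tfam u -> exists n (t' u' : term C n),
  (forall w e, eval (I w) (env n e) t' = t w e) /\
  (forall w e, eval (I w) (env n e) u' = u w e).
Proof.
move=> /tfam_term[n1 h1] /tfam_term[n2 h2].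
have [t' ht] := h1 _ (leq_maxl n1 n2); have [u' hu] := h2 _ (leq_maxr n1 n2).
by exists (maxn n1 n2), t', u'.
Qed.

Lemma fam_mem t u : tfam t -> tfam u -> fam (fun _ w e => t w e \In u w e).
Proof.
move=> ht /(tfam_term2 ht)[n [t' [u' [h1 h2]]]].
exists n, (fun=> Defs.Mem t' u'); split; first exact: rfun_const.
by move=> k w e /=; rewrite h1 h2.
Qed.

Lemma fam_eq t u : tfam t -> tfam u -> fam (fun _ w e => t w e = u w e).
Proof.
move=> ht /(tfam_term2 ht)[n [t' [u' [h1 h2]]]].
exists n, (fun=> Defs.Eq t' u'); split; first exact: rfun_const.
by move=> k w e /=; rewrite h1 h2.
Qed.

Lemma fam_imp Q Q' : fam Q -> fam Q' -> fam (fun k w e => Q k w e -> Q' k w e).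
Proof.
move=> fQ /(fam2 fQ)[n [phi [psi [r1 r2 h1 h2]]]].
exists n, (fun k => Imp (phi k) (psi k)); split=> [|k w e /=].
  by apply/rfun_pair/rfun_pair => //; apply: rfun_const.
by rewrite h1 h2.
Qed.

Lemma fam_all (Q : nat -> forall w, str w -> (nat -> str w) -> Prop) :
  fam (fun k w e => Q k w (e 0) (fun i => e i.+1)) ->
  fam (fun k w e => forall x, Q k w x e).
Proof.
move=> /(@fam_min _ 1)[[//|n] _ [phi [r h]]].
exists n, (fun k => All (phi k)); split=> [|k w e /=].
  by apply/rfun_pair => //; apply: rfun_const.
by split=> h' x; have := h' x; rewrite env_scons h.
Qed.

Lemma fam_not Q : fam Q -> fam (fun k w e => ~ Q k w e).
Proof. by move=> fQ; apply: fam_imp fQ fam_bot. Qed.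

Lemma fam_and Q Q' : fam Q -> fam Q' -> fam (fun k w e => Q k w e /\ Q' k w e).
Proof.
move=> f1 f2; apply: fam_iff (fam_not (fam_imp f1 (fam_not f2))) _ => k w e.
by case: (pselect (Q k w e)); case: (pselect (Q' k w e)); tauto.
Qed.

Lemma fam_or Q Q' : fam Q -> fam Q' -> fam (fun k w e => Q k w e \/ Q' k w e).
Proof.
move=> f1 f2; apply: fam_iff (fam_imp (fam_not f1) f2) _ => k w e.
by case: (pselect (Q k w e)); case: (pselect (Q' k w e)); tauto.
Qed.

Lemma fam_equiv Q Q' : fam Q -> fam Q' -> fam (fun k w e => Q k w e <-> Q' k w e).
Proof. by move=> f1 f2; apply: fam_and; apply: fam_imp. Qed.

Lemma fam_ex (Q : nat -> forall w, str w -> (nat -> str w) -> Prop) :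
  fam (fun k w e => Q k w (e 0) (fun i => e i.+1)) ->
  fam (fun k w e => exists x, Q k w x e).
Proof.
move=> fQ; apply: fam_iff (fam_not (fam_all (Q := fun k w x e => ~ Q k w x e) _)) _.
  exact: fam_not fQ.
by move=> k w e /=; rewrite not_existsP; split=> [h1 /h1//|h1 h2]; apply: h1 => x /h2.
Qed.

Lemma fam_ex2 (Q Q' : nat -> forall w, str w -> (nat -> str w) -> Prop) :
  fam (fun k w e => Q k w (e 0) (fun i => e i.+1)) ->
  fam (fun k w e => Q' k w (e 0) (fun i => e i.+1)) ->
  fam (fun k w e => exists2 x, Q k w x e & Q' k w x e).
Proof.
move=> f1 f2; apply: fam_iff (fam_ex (Q := fun k w x e => Q k w x e /\ Q' k w x e)
  (fam_and f1 f2)) _ => k w e.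
by split=> [[x []]|[x]]; exists x.
Qed.

Lemma fam_and3 Q1 Q2 Q3 : fam Q1 -> fam Q2 -> fam Q3 ->
  fam (fun k w e => [/\ Q1 k w e, Q2 k w e & Q3 k w e]).
Proof.
move=> f1 f2 f3; apply: fam_iff (fam_and f1 (fam_and f2 f3)) _ => k w e.
by split=> [[? []]|[]].
Qed.

Lemma fam_and4 Q1 Q2 Q3 Q4 : fam Q1 -> fam Q2 -> fam Q3 -> fam Q4 ->
  fam (fun k w e => [/\ Q1 k w e, Q2 k w e, Q3 k w e & Q4 k w e]).
Proof.
move=> f1 f2 f3 f4; apply: fam_iff (fam_and f1 (fam_and3 f2 f3 f4)) _ => k w e.
by split=> [[? []]|[]].
Qed.

Lemma fam_and5 Q1 Q2 Q3 Q4 Q5 : fam Q1 -> fam Q2 -> fam Q3 -> fam Q4 -> fam Q5 ->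
  fam (fun k w e => [/\ Q1 k w e, Q2 k w e, Q3 k w e, Q4 k w e & Q5 k w e]).
Proof.
move=> f1 f2 f3 f4 f5; apply: fam_iff (fam_and f1 (fam_and4 f2 f3 f4 f5)) _ => k w e.
by split=> [[? []]|[]].
Qed.

Lemma fam_or3 Q1 Q2 Q3 : fam Q1 -> fam Q2 -> fam Q3 ->
  fam (fun k w e => [\/ Q1 k w e, Q2 k w e | Q3 k w e]).
Proof.
move=> f1 f2 f3; apply: fam_iff (fam_or f1 (fam_or f2 f3)) _ => k w e.
by split=> [[?|[]]|[]]; by [constructor 1|constructor 2|constructor 3|left|right;left|right;right].
Qed.

(** R(x_i) is written as: for all x_0, if x_0 = x_i then R(x_0).  The code of the
    given formula is used unchanged, so the family remains recursive. *)
Lemma fam_at (R : nat -> forall w, str w -> Prop) i :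
  fam (fun k w e => R k w (e 0)) -> fam (fun k w e => R k w (e i)).
Proof.
move=> fR; apply: fam_iff (fam_all (Q := fun k w x e => x = e i -> R k w x) _) _.
  by apply: fam_imp => //; apply: fam_eq; left; [exists 0|exists i.+1].
by move=> k w e; split=> [h|h x ->]; first exact: h.
Qed.

(** The sequence of conjunctions of initial segments is defined by primitive
    recursion, on formulas as well as on codes. *)
Lemma fam_forall_lt Q : fam Q -> fam (fun K w e => forall k, k < K -> Q k w e).
Proof.
case=> n [phi [r h]].
pose psi := fix psi K : form C n := if K is K'.+1 then
  Imp (Imp (psi K') (Imp (phi K') Bot)) Bot else Imp Bot Bot.
exists n, psi; split.
  pose g k r := cpair 3 (cpair (cpair 3 (cpair r (cpair 3 (cpair (code (phi k)) (cpair 0 0)))))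
     (cpair 0 0)).
  apply: (@rfun_rec1 (fun k => code (psi k)) g) => //.
  have r' : rfun 2 (fun v => code (phi (v 0))).
    by apply: (rfun_ap1 (f := fun x => code (phi x))) r _; apply: rfun_var.
  by rewrite /g; rfun_tac.
elim=> [|K IH] w e /=; first by split.
rewrite IH h; split=> [h1 k|h1 h2].
  rewrite ltnS leq_eqVlt; case: (pselect (Q K w e)) => [Qk|]; last by tauto.
  case/orP=> [/eqP-> //|lt_kK]; apply: contrapT => nQ; apply: h1 => h1 _.
  exact/nQ/h1.
by apply: h2 => [k lt_kK|]; apply: h1 => //; apply: ltnW.
Qed.

End Families.

Ltac tfam_tac := first [left; eexists; reflexivity | right; eexists; reflexivity].

(** Predicates are reified by following their connectives; the environment of
    the body of a quantifier is the shifted one, as for de Bruijn indices. *)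
Ltac fam_step := cbv beta; match goal with
  | |- fam _ (fun k w e => False) => apply: fam_bot
  | |- fam _ (fun k w e => ~ _) => apply: fam_not
  | |- fam _ (fun k w e => _ /\ _) => apply: fam_and
  | |- fam _ (fun k w e => _ \/ _) => apply: fam_or
  | |- fam _ (fun k w e => _ <-> _) => apply: fam_equiv
  | |- fam _ (fun k w e => exists x, _) => apply: fam_ex
  | |- fam _ (fun k w e => exists2 x, _ & _) => apply: fam_ex2
  | |- fam _ (fun k w e => [/\ _, _ & _]) => apply: fam_and3
  | |- fam _ (fun k w e => [/\ _, _, _ & _]) => apply: fam_and4
  | |- fam _ (fun k w e => [/\ _, _, _, _ & _]) => apply: fam_and5
  | |- fam _ (fun k w e => [\/ _, _ | _]) => apply: fam_or3
  | |- fam _ (fun k w e => _ \In _) => apply: fam_mem; tfam_tac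
  | |- fam _ (fun k w e => _ = _) => apply: fam_eq; tfam_tac
  | |- fam _ (fun k w e => _ -> _) => apply: fam_imp
  | |- fam _ (fun k w e => forall x, _) => apply: fam_all
  end.
Ltac fam_tac :=
  rewrite /rank_lt_ord /rank_le /has_rank /ordinal_of /wellordered_by_mem /transitive_set
  /Defs.is_fun /app /is_opair /is_upair /is_succ /is_subset /is_empty /unique;
  repeat fam_step.

Section Numerals.
Variables (C W : Type) (str : W -> structure) (I : forall w, C -> str w).

(** The formula for k + 1 applies the one for k to the variable 0 bound by a new
    quantifier, so its code is obtained from the code for k by pairing. *)
Lemma fam_numeral i : fam I (fun k w e => numeral k (e i)).
Proof.
apply: (fam_at (R := fun k w x => numeral k x)).
(* The negation of the successor relation is used because the existential
   quantifier is expressed by the universal one. *)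
have f0 : fam I (fun k w e => is_empty (e 0)) by fam_tac.
have fS : fam I (fun k w e => ~ is_succ (e 1) (e 0)) by fam_tac.
have [n [phi [psi [_ _ hphi hpsi]]]] := fam2 f0 fS.
pose chi := fix chi k : form C n := if k is k'.+1 then
  Imp (All (Imp (widen (leqnSn n) (chi k')) (widen (leqnSn n) (psi 0)))) Bot else phi 0.
exists n, chi; split.
  pose g (k r : nat) := cpair 3 (cpair (cpair 4 (cpair 3 (cpair r (code (psi 0))))) (cpair 0 0)).
  apply: (@rfun_rec1 (fun k => code (chi k)) g) => [|k].
    by rewrite /g; rfun_tac.
  by rewrite /= !code_subst.
elim=> [|k IH] w e; first exact: hphi.
transitivity (~ forall y : str w, numeral k y -> ~ is_succ (e 0) y).
  split=> h h'; apply: h => y.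
  - rewrite env_scons; move=> /sat_widen/IH ky.
    by apply/sat_widen/hpsi; apply: h'.
  - move=> ky; have := h' y; rewrite env_scons => h.
    have hk : sat (I w) (widen (leqnSn n) (chi k)) (env n.+1 (scons y e)).
      by apply/sat_widen/IH.
    by have /sat_widen/hpsi := h hk.
split=> [|[y ky sy] h]; last exact: h sy.
by move=> h; apply: contrapT => h'; apply: h => y ky sy; apply: h'; exists y.
Qed.
End Numerals.

Definition ufam (Q : nat -> forall M : structure, (nat -> M) -> Prop) : Prop :=
  fam (fun M : structure => of_void M) Q.

Definition truth k (M : structure) (z : M) : Prop :=
  exists2 phi : L0 1, godel phi = k & sat0 phi [tuple z].

(** The k-th formula is the one with Goedel number k, or else falsity.  Its code
    is k or 0 according to a recursive test, namely [scope]. *)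
Lemma ufam_truth : ufam (fun k M e => truth k (e 0)).
Proof.
pose phi k : L0 1 := if pselect (exists phi : L0 1, godel phi = k) is left h
  then projT1 (cid h) else Bot.
have phiP psi : phi (godel psi) = psi.
  by rewrite /phi; case: pselect => [h|[]]; [apply: godel_inj; case: (cid h)|exists psi].
exists 1, phi; split.
  have r : rfun 1 (fun v => if (0 < scope (v 0)) * (scope (v 0) <= 2) == 0 then cpair 0 0 else v 0).
    by apply: rfun_if0; rfun_tac; apply: rfun_scope; rfun_tac.
  apply: rfun_ext r _ => v; rewrite mulnb; rewrite /phi.
  case: pselect => [h|h].
    by have /godelP-> := h; rewrite code_godel; case: (cid h).
  by case: ifP => // hs; case: h; apply/godelP; move: hs; case: (_ && _).
move=> k M e; rewrite (_ : env 1 e = [tuple e 0]); last first.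
  by apply: eq_from_tnth => i; rewrite tnth_mktuple ord1.
split=> [|[psi <-]]; last by rewrite phiP.
rewrite /phi; case: pselect => // h.
by case: (cid h) => psi /= e0; exists psi.
Qed.

(** A value c of g can only be taken at an argument k <= c, so the search is
    bounded. *)
Lemma recursive_range (g : nat -> nat) : rfun 1 (fun v => g (v 0)) ->
  (forall k, k <= g k) -> recursive_set (range g).
Proof.
move=> rg le_g; rewrite /recursive_set.
pose h := fix h K c := if K is K'.+1 then maxn (h K' c) (g K' == c) else 0.
have rh : rfun 2 (fun v => h (v 0) (v 1)).
  apply: (@rfun_rec2 h (fun K r c => maxn r (g K == c))) => //=; first exact: rfun_const.
  by rfun_tac; apply: (rfun_ap1 rg); rfun_tac.
have hP K c : h K c = has (fun k => g k == c) (iota 0 K) :> nat.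
  elim: K => // K IH; rewrite -addn1 iotaD has_cat addn1 /= IH orbF.
  by case: has; case: eqP.
have r : rfun 1 (fun v => h (v 0).+1 (v 0)) by apply: (rfun_ap2 rh); rfun_tac.
apply: recursive_ext r _ => v; rewrite hP; congr nat_of_bool; rewrite /thead (tnth_nth 0).
apply/asboolP/hasP => [[k _ <-]|[k _ /eqP <-]]; last by exists k.
by exists k; rewrite ?mem_iota //= ltnS le_g.
Qed.

Lemma finite_range (T : Type) (f : nat -> T) (F : set T) :
  finite_set F -> F `<=` range f -> exists K, forall x, F x -> exists2 k, k < K & f k = x.
Proof.
move=> finF subF.
have /choice[g hg] : forall x, exists k, F x -> f k = x.
  by move=> x; have [/subF[k _ <-]|nF] := pselect (F x); [exists k|exists 0].
have /finite_seqP[s es] := finite_image g finF.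
exists (\max_(i <- s) i).+1 => x Fx; exists (g x); last exact: hg.
have : g x \in s by have : [set` s] (g x) by rewrite -es; exists x.
by move=> gs; rewrite ltnS; apply: (leq_bigmax_seq _ gs).
Qed.

(** Recursive saturation for types that are enumerated by a recursive sequence of
    formulas.  By Craig's trick such a type can be given by a recursive set: the
    k-th formula is prefixed by a valid hypothesis whose Goedel number is at
    least k. *)
Lemma uniform_saturation (M : structure) Q (e : nat -> M) :
  recursively_saturated M -> ufam Q ->
  (forall K, exists x, forall k, k < K -> Q k M (scons x e)) ->
  exists x, forall k, Q k M (scons x e).
Proof.
(* The k-th formula of the type is the conjunction of the first k ones, so a
   finite part of the type follows from a single formula. *)
move=> satM /fam_forall_lt/(@fam_min _ _ _ _ _ 1)[[//|m] _ [phi [rphi hphi]]] fin.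
pose pad := fix pad k : L0 m.+1 := if k is k'.+1 then Imp Bot (pad k') else Imp Bot Bot.
have padP k (v : m.+1.-tuple M) : sat0 (pad k) v by case: k => [|k] [].
pose psi k := Imp (pad k) (phi k).
have le_psi k : k <= godel (psi k).
  have le_pad : k <= godel (pad k).
    elim: k => // k IH.
    apply: leq_trans (leq_cpair 3 (cpair (cpair 0 0) (godel (pad k)))).
    by have := leq_cpair (cpair 0 0) (godel (pad k)); lia.
  apply: leq_trans (leq_cpair 3 (cpair (godel (pad k)) (godel (phi k)))).
  by have := leq_cpair (godel (pad k)) (godel (phi k)); lia.
have rpsi : rfun 1 (fun v => godel (psi (v 0))).
  have rpad : rfun 1 (fun v => code (pad (v 0))).
    apply: (@rfun_rec1 (fun k => code (pad k))
      (fun _ r => cpair 3 (cpair (cpair 0 0) r))); last by reflexivity.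
    by rfun_tac.
  apply: rfun_ext (rfun_pair (rfun_const 1 3) (rfun_pair rpad rphi)) _ => v.
  by rewrite -code_godel /psi /=.
have tupE (x : 1.-tuple M) : [tuple of x ++ env m e] = env m.+1 (scons (thead x) e).
  rewrite -env_scons; apply: val_inj; case/tupleP: x => a x; rewrite (tuple0 x) /=.
  by rewrite theadE.
have [||x hx] := satM 1 m (range psi) (env m e).
- rewrite (_ : _ @` _ = range (fun k => godel (psi k))).
    exact: recursive_range rpsi le_psi.
  by rewrite image_comp.
- move=> F finF subF; have [K hK] := finite_range finF subF.
  have [x hx] := fin K; exists [tuple x] => p /hK[k lt_kK <-] _; rewrite tupE.
  by apply/hphi => j lt_jk; apply/hx/(ltn_trans lt_jk).
- exists (thead x) => k; have := hx (psi k.+1) (ex_intro2 _ _ k.+1 I erefl).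
  by rewrite tupE => h; have /hphi := h (padP k.+1 _); apply.
Qed.

(** * Definable classes of a model of set theory *)

Definition mfam (M : structure) (Q : (nat -> M) -> Prop) : Prop :=
  fam (C := M) (W := unit) (str := fun=> M) (fun _ c => c) (fun _ _ e => Q e).

(** A formula mentions finitely many constants; they become trailing variables. *)
Lemma absorb_constants (M : structure) n (phi : form M n.+1) :
  exists m (p : m.-tuple M) (chi : L0 (n.+1 + m)), forall v : n.+1.-tuple M,
    sat0 chi [tuple of v ++ p] <-> sat id phi v.
Proof.
pose p := in_tuple (csts phi); pose m := size (csts phi).
pose r (c : M) : term void (n.+1 + m) := Var void
  (if pselect (exists i, tnth p i = c) is left h then rshift n.+1 (projT1 (cid h)) else lshift m ord0).
(* The default value [ord0] is taken only at constants that do not occur. *)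
exists m, p, (subst phi (fun i => Var void (lshift m i)) r) => v.
apply: sat_subst => [i|c hc] /=; first by rewrite tnth_lshift.
case: pselect => [h|[]]; first by rewrite tnth_rshift; case: (cid h).
elim: (csts phi) hc @p {m r} => //= a s IH [->|/IH [i hi]]; first by exists ord0.
by exists (lift ord0 i); rewrite -hi !(tnth_nth a).
Qed.

Definition definable1 (M : structure) (A : M -> Prop) := mfam (fun e => A (e 0)).
Definition definable2 (M : structure) (R : M -> M -> Prop) := mfam (fun e => R (e 0) (e 1)).

Ltac def_tac := rewrite /definable1 /definable2 /mfam; fam_tac.

Section ZFTheory.
Variables (M : structure) (ZFM : ZF M).
Implicit Types (x y z a b : M) (A : M -> Prop) (R : M -> M -> Prop).

(** Besides the parameters, the unused variables of the formula have to be given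
    some value, here a0. *)
Lemma definable2_formula R a0 : definable2 R -> exists n (chi : L0 n.+2) (v : n.-tuple M),
  forall x y, sat0 chi [tuple of x :: y :: v] <-> R x y.
Proof.
move=> /(@fam_min _ _ _ _ _ 2)[[//|[//|n]] _ [phi [_ h]]].
have [m [p [chi hchi]]] := absorb_constants (phi 0).
exists (n + m), chi, [tuple of env n (fun=> a0) ++ p] => x y.
rewrite -(h 0 tt (scons x (scons y (fun=> a0)))) -hchi.
suff -> : [tuple of x :: y :: [tuple of env n (fun=> a0) ++ p]] =
  [tuple of env n.+2 (scons x (scons y (fun=> a0))) ++ p] :> (n.+2 + m).-tuple M by [].
by apply: val_inj; rewrite -!env_scons.
Qed.

Lemma separation A a : definable1 A -> exists b, forall x, x \In b <-> x \In a /\ A x.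
Proof.
move=> dA; have d2 : definable2 (fun x y => A x) by exact: dA.
have [n [chi [v h]]] := definable2_formula a d2.
have [b hb] := ZF_separation ZFM chi [tuple of a :: v] a.
by exists b => x; rewrite hb -(h x a).
Qed.

Lemma replacement R a : definable2 R ->
  (forall x y y', x \In a -> R x y -> R x y' -> y = y') ->
  exists b, forall y, y \In b <-> exists2 x, x \In a & R x y.
Proof.
move=> /(definable2_formula a)[n [chi [v h]]] fR.
have [|b hb] := ZF_replacement ZFM (phi := chi) (v := v) (a := a).
  by move=> x y y' xa /h Rxy /h; apply: fR Rxy.
by exists b => y; rewrite hb; split=> [[x xa /h]|[x xa /h]]; exists x.
Qed.

(** * Ordered pairs *)

Lemma mem_irrefl x : ~ x \In x.
Proof.
have [s hs] := ZF_pairing ZFM x x.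
have [|y /hs[]-> h] := ZF_foundation ZFM (x := s); first by exists x; apply/hs; left.
  by apply: h; apply/hs; left.
by apply: h; apply/hs; left.
Qed.

Lemma opair_ex x y : exists p, is_opair p x y.
Proof.
have [s hs] := ZF_pairing ZFM x x; have [t ht] := ZF_pairing ZFM x y.
have [p hp] := ZF_pairing ZFM s t; exists p => z; rewrite hp.
by split=> -[h|h]; [left|right|left|right]; [rewrite h|rewrite h|apply: ZF_extensionality => // w..];
   rewrite ?hs ?ht //; apply: h.
Qed.

Definition op x y : M := projT1 (cid (opair_ex x y)).
Lemma opP x y : is_opair (op x y) x y.
Proof. by rewrite /op; case: cid. Qed.

Lemma opairE p x y : is_opair p x y <-> p = op x y.
Proof.
split=> [h|->]; last exact: opP.
by apply: ZF_extensionality => // z; rewrite (h z) (opP x y z).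
Qed.

Lemma op_inj x y x' y' : op x y = op x' y' -> x = x' /\ y = y'.
Proof.
move=> e; have h z : (is_upair z x x \/ is_upair z x y) <-> (is_upair z x' x' \/ is_upair z x' y').
  by rewrite -(opP x y z) e (opP x' y' z).
have [s hs] := ZF_pairing ZFM x x; have [t ht] := ZF_pairing ZFM x y.
have [s' hs'] := ZF_pairing ZFM x' x'; have [t' ht'] := ZF_pairing ZFM x' y'.
have ex : x = x'.
  have [k|k] := (h s).1 (or_introl hs).
    by have /hs[] : x' \In s by apply/k; left.
  by have /hs[] : x' \In s by apply/k; left.
split=> //; subst x'; clear e.
have k1 : y = x \/ y = y'.
  have [k|k] := (h t).1 (or_intror ht); have /k : y \In t by apply/ht; right.
  - by case; left.
  - by [].
have k2 : y' = x \/ y' = y.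
  have [k|k] := (h t').2 (or_intror ht'); have /k : y' \In t' by apply/ht'; right.
  - by case; left.
  - by [].
by case: k1 k2 => [->|//] [->|->].
Qed.

Lemma appE f x y : app f x y <-> op x y \In f.
Proof. by split=> [[p /opairE->]|h] //; exists (op x y) => //; apply: opP. Qed.

Lemma cup_ex a b : exists c, forall x, x \In c <-> x \In a \/ x \In b.
Proof.
have [p hp] := ZF_pairing ZFM a b; have [u hu] := ZF_union ZFM p.
exists u => x; rewrite hu; split=> [[y /hp[]->]|[]]; [by left|by right| |].
  by exists a => //; apply/hp; left.
by exists b => //; apply/hp; right.
Qed.

Lemma succ_ex a : exists b, is_succ b a.
Proof.
have [s hs] := ZF_pairing ZFM a a; have [c hc] := cup_ex a s.
by exists c => x; rewrite hc hs; split=> [[|[]]|[]]; auto.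
Qed.

(** * Ordinals *)

Local Notation Ord := (@ordinal_of M).

Lemma ord_trans a : Ord a -> forall x y, x \In y -> y \In a -> x \In a.
Proof. by case=> h _ x y xy ya; apply: h xy. Qed.

Lemma ord_mem a x : Ord a -> x \In a -> Ord x.
Proof.
move=> [ta [ia tra tri wa]] xa; have sub := ta _ xa; split.
  by move=> y yx z zy; apply: (tra z y x) => //; [apply: ta zy; apply: sub|apply: sub].
split=> [y /sub/ia //|y z w /sub ya /sub za /sub wa'|y z /sub ya /sub za|u ux].
- exact: tra.
- exact: tri.
- by apply: wa => w /ux/sub.
Qed.

(** If a is not a subset of b, then a minimal element m of a \ b equals the
    intersection of a and b, which is thus an element of a.  If also b is not a
    subset of a, the same intersection is an element of b, hence of itself. *)
Lemma ord_trichotomy a b : Ord a -> Ord b -> [\/ a \In b, a = b | b \In a].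
Proof.
have main c d : Ord c -> Ord d -> is_subset c d \/
    exists2 m, m \In c & forall z, z \In m <-> z \In c /\ z \In d.
  move=> oc od; have [i hi] : exists i, forall x, x \In i <-> x \In c /\ ~ x \In d.
    by apply: separation; def_tac.
  have [[x xi]|no] := pselect (exists x, x \In i); last first.
    by left=> x xc; apply: contrapT => nxd; apply: no; exists x; apply/hi.
  right; have [|m mi hm] := ZF_foundation ZFM (x := i); first by exists x.
  have /hi[mc nmd] := mi; exists m => // z; split=> [zm|[zc zd]].
    have zc := ord_trans oc zm mc; split=> //.
    by apply: contrapT => nzd; apply: hm zm; apply/hi.
  have [_ [_ _ tri _]] := oc; case: (tri z m zc mc) => [//|e|mz].
    by case: nmd; rewrite -e.
  case: nmd. exact: (ord_trans od mz zd).
move=> oa ob; have [sab|[m ma hm]] := main a b oa ob; last first.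
  have [sba|[m' m'b hm']] := main b a ob oa.
    rewrite (_ : b = m); first by constructor 3.
    by apply: ZF_extensionality => // z; rewrite hm; split=> [zb|[]//]; split=> //; apply: sba.
  have e : m = m' by apply: ZF_extensionality => // z; rewrite hm hm'; tauto.
  by case: (@mem_irrefl m); apply/hm; split=> //; rewrite e.
have [sba|[m mb hm]] := main b a ob oa.
  by constructor 2; apply: ZF_extensionality => // z; split; [apply: sab|apply: sba].
rewrite (_ : a = m); first by constructor 1.
by apply: ZF_extensionality => // z; rewrite hm; split=> [za|[]//]; split=> //; apply: sab.
Qed.

(** Foundation provides minimal elements, and trichotomy makes them least. *)
Lemma ord_intro a : transitive_set a -> (forall x, x \In a -> Ord x) -> Ord a.
Proof.
move=> ta oa; split=> //; split=> [x _|x y z _ _ za xy yz|x y xa ya|u ua ex].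
- exact: mem_irrefl.
- exact: (ord_trans (oa z za) xy yz).
- by apply: ord_trichotomy; apply: oa.
- have [m mu hm] := ZF_foundation ZFM ex; exists m => // y yu.
  case: (ord_trichotomy (oa _ (ua _ mu)) (oa _ (ua _ yu))); [by right|by left|].
  by move=> ym; case: (hm y).
Qed.

Lemma ord_succ a b : Ord a -> is_succ b a -> Ord b.
Proof.
move=> oa hb; apply: ord_intro => [x /hb xa y yx|x /hb[/(ord_mem oa)|->]] //.
by apply/hb; left; case: xa => [xa|<-] //; exact: (ord_trans oa yx xa).
Qed.

Lemma ord_least A a : definable1 A -> Ord a -> A a ->
  exists b, [/\ Ord b, A b & forall c, c \In b -> ~ A c].
Proof.
move=> dA oa Aa; have [i hi] := separation a dA.
have [ex|no] := pselect (exists x, x \In i).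
  have [m /hi[ma Am] hm] := ZF_foundation ZFM ex; exists m; split=> //.
    exact: (ord_mem oa ma).
  by move=> c cm Ac; case: (hm c) => //; apply/hi; split=> //; exact: (ord_trans oa cm ma).
by exists a; split=> // c ca Ac; apply: no; exists c; apply/hi.
Qed.

Lemma ord_ind A : definable1 A ->
  (forall a, Ord a -> (forall b, b \In a -> A b) -> A a) -> forall a, Ord a -> A a.
Proof.
move=> dA IH a oa; apply: contrapT => nAa.
have [b [ob nAb hb]] : exists b, [/\ Ord b, ~ A b & forall c, c \In b -> ~ ~ A c].
  by apply: ord_least nAa => //; apply: fam_not.
by apply: nAb; apply: IH => // c cb; apply: contrapT; apply: hb.
Qed.

(** * Ranks and levels *)

Lemma fun_total f a b x : Defs.is_fun f a b -> x \In a -> exists y, app f x y.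
Proof. by case=> _ h /h[y [hy _]]; exists y. Qed.
Lemma fun_unique f a b x y y' : Defs.is_fun f a b -> x \In a -> app f x y -> app f x y' -> y = y'.
Proof. by case=> _ h /h[z [hz hu]] /hu <- /hu <-. Qed.

(** Two rank functions agree on the intersection of their domains: an element
    that is minimal among those where they differ would have the same values at
    all its elements, hence the same rank.  The elements where they differ form
    a set, to which foundation applies. *)
Lemma rank_unique x u u' : has_rank x u -> has_rank x u' -> u = u'.
Proof.
move=> [t [b [f [tt xt ff rf fx]]]] [t' [b' [f' [tt' xt' ff' rf' fx']]]].
apply: contrapT => ne.
have [i hi] : exists i, forall x, x \In i <-> x \In t /\ (x \In t' /\
    exists u u', [/\ app f x u, app f' x u' & u <> u']).
  by apply: separation; def_tac.
have [|y /hi[yt [yt' [v [v' [fy fy' ne']]]]] hy] := ZF_foundation ZFM (x := i).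
  by exists x; apply/hi; split=> //; split=> //; exists u, u'.
apply: ne'; have agree z w : z \In y -> app f z w <-> app f' z w.
  move=> zy; have zt := tt _ yt _ zy; have zt' := tt' _ yt' _ zy.
  have [s fs] := fun_total ff zt; have [s' fs'] := fun_total ff' zt'.
  have es : s = s'.
    apply: contrapT => ne'; case: (hy z) => //; apply/hi; split=> //; split=> //.
    by exists s, s'.
  by split=> h; [rewrite (fun_unique ff zt h fs) es|rewrite (fun_unique ff' zt' h fs') -es].
apply: ZF_extensionality => // w; rewrite (rf _ _ yt fy) (rf' _ _ yt' fy').
by split=> -[z [s [zy fz h]]]; exists z, s; split=> //; apply/agree.
Qed.

Lemma rank_mem_ex x u z : has_rank x u -> z \In x -> exists v, has_rank z v.
Proof.
move=> [t [b [f [tt xt ff rf fx]]]] zx; have zt := tt _ xt _ zx.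
by have [v fz] := fun_total ff zt; exists v, t, b, f.
Qed.

(** The recursion clause no longer mentions the rank function that witnesses it,
    because the same function also witnesses the ranks of the elements of x. *)
Lemma rankP x u : has_rank x u -> forall w, w \In u <->
  exists z v, [/\ z \In x, has_rank z v & w \In v \/ w = v].
Proof.
move=> hx; have [t [b [f [tt xt ff rf fx]]]] := hx.
move=> w; rewrite (rf _ _ xt fx); split=> -[z [v [zx hz hw]]]; exists z, v; split=> //.
  by exists t, b, f; split=> //; apply: tt zx.
have zt := tt _ xt _ zx; have [v' fz] := fun_total ff zt.
rewrite (rank_unique hz (u' := v')) //.
by exists t, b, f.
Qed.

Lemma rank_mem x u z v : has_rank x u -> has_rank z v -> z \In x -> v \In u.
Proof. by move=> hx hz zx; apply/(rankP hx); exists z, v; split=> //; right. Qed.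

Lemma rank_ord x u : has_rank x u -> Ord u.
Proof.
move=> hx; have [t [b [f [tt xt ff rf fx]]]] := hx; apply: contrapT => no.
have [i hi] : exists i, forall x, x \In i <-> x \In t /\ exists2 u, app f x u & ~ Ord u.
  by apply: separation; def_tac.
have [|y /hi[yt [v fy nov]] hy] := ZF_foundation ZFM (x := i).
  by exists x; apply/hi; split=> //; exists u.
have oz z s : z \In y -> app f z s -> Ord s.
  move=> zy fz; apply: contrapT => nos; case: (hy z) => //; apply/hi; split; first exact: (tt y).
  by exists s.
apply/nov/ord_intro => [w|w] /(rf _ _ yt fy)[z [s [zy fz hw]]].
  move=> r rw; apply/(rf _ _ yt fy); exists z, s; split=> //; left.
  by case: hw rw => [ws rw|-> //]; exact: (ord_trans (oz _ _ zy fz) rw ws).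
by case: hw => [ws|->]; [apply: ord_mem ws|]; apply: oz fz.
Qed.

(** By induction on ordinals: an element of rank d < a is a subset of the level
    d, so the level a is carved out of the union of the power sets of the lower
    levels. *)
Lemma level_ex a : Ord a -> exists V, forall x, x \In V <-> rank_lt_ord x a.
Proof.
apply: (ord_ind (A := fun a => exists V, forall x, x \In V <-> rank_lt_ord x a)).
  by def_tac.
move=> {}a oa IH.
have [|d P P' _ h h'|B hB] := @replacement
    (fun d P => forall y, y \In P <-> forall x, x \In y -> rank_lt_ord x d) a.
- by def_tac.
- by apply: ZF_extensionality => // y; rewrite h h'.
have [U hU] := ZF_union ZFM B.
have [V hV] : exists V, forall x, x \In V <-> x \In U /\ rank_lt_ord x a.
  by apply: separation; def_tac.
exists V => x; rewrite hV; split=> [[]//|hx]; split=> //; have [u xu ua] := hx.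
have [V' hV'] := IH u ua; have [P hP] := ZF_powerset ZFM V'.
apply/hU; exists P.
  apply/hB; exists u => // y; rewrite hP.
  by split=> h z /h /hV'.
apply/hP => z zx; apply/hV'; have [v hz] := rank_mem_ex xu zx.
by exists v => //; apply: rank_mem zx.
Qed.

(** A set of elements of rank less than a has itself a rank.  On the level a the
    rank is a function by replacement, and it extends to x with the value r
    dictated by the recursion. *)
Lemma rank_subset_level a x : Ord a -> (forall y, y \In x -> rank_lt_ord y a) ->
  exists2 u, has_rank x u & u \In a \/ u = a.
Proof.
move=> oa xa; have [V hV] := level_ex oa.
(* If x is in the level, its rank is known, and adding the pair (x, r) to the
   rank function could spoil functionality. *)
have [/hV[u hu ua]|nxV] := pselect (x \In V); first by exists u => //; left.
have [t ht] : exists t, forall y, y \In t <-> y \In V \/ y = x.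
  by have := succ_ex x; have [s hs] := ZF_pairing ZFM x x; have [t ht] := cup_ex V s;
    exists t => y; rewrite ht hs; tauto.
have [r hr] : exists r, forall w, w \In r <-> w \In a /\
    exists z v, [/\ z \In x, has_rank z v & w \In v \/ w = v].
  by apply: separation; def_tac.
have [b hb] : exists b, forall w, w \In b <-> w \In a \/ w = r.
  by have [s hs] := ZF_pairing ZFM r r; have [b hb] := cup_ex a s;
    exists b => y; rewrite hb hs; tauto.
pose F y u := (y \In V /\ has_rank y u) \/ (y = x /\ u = r).
have FU y u u' : F y u -> F y u' -> u = u'.
  case=> [[yV hy]|[ey ->]] [[yV' hy']|[ey' ->]] //; first exact: rank_unique hy hy'.
  - by case: nxV; rewrite -ey'.
  - by case: nxV; rewrite -ey.
have [|y p p' yt [u Fu /opairE->] [u' Fu' /opairE->]|f hf] := @replacement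
    (fun y p => exists2 u, F y u & is_opair p y u) t.
- by rewrite /F; def_tac.
- by rewrite (FU _ _ _ Fu Fu').
have fE y u : app f y u <-> y \In t /\ F y u.
  rewrite appE hf; split=> [[z zt [v Fv /opairE/op_inj[-> ->]]] //|[yt Fu]].
  by exists y => //; exists u => //; apply: opP.
have FT y : y \In t -> exists2 u, F y u & u \In b.
  move=> /ht[yV|->]; last by exists r; [right|apply/hb; right].
  by have /hV[u hu ua] := yV; exists u; [left|apply/hb; left].
have hx : has_rank x r.
  exists t, b, f; split.
  - move=> y /ht yt z zy; apply/ht; left; apply/hV; case: yt => [/hV[u hu ua]|ey].
      have [v hv] := rank_mem_ex hu zy; exists v => //.
      by exact: (ord_trans oa (rank_mem hu hv zy) ua).
    by apply: xa; rewrite -ey.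
  - by apply/ht; right.
  - split=> [p /hf[y yt [u Fu pu]]|y yt].
      exists y, u; split=> //; have [u' Fu' u'b] := FT y yt.
      by rewrite (FU _ _ _ Fu Fu').
    have [u Fu ub] := FT y yt; exists u; split; first by apply/fE.
    by move=> u' /fE[_ /(FU _ _ _ Fu)].
  - move=> y u yt /fE[_ [[yV hu]|[-> ->]]] w.
      have /hV[u' hu' ua] := yV; have eu := rank_unique hu hu'; rewrite -{}eu in hu' ua.
      rewrite (rankP hu); split=> -[z [v [zy hz hw]]]; exists z, v; split=> //.
        have zV : z \In V by apply/hV; exists v => //; apply: (ord_trans oa (rank_mem hu hz zy) ua).
        by apply/fE; split; [apply/ht; left|left].
      case/fE: hz => _ [[]//|[ez _]]; case: nxV; rewrite -ez; apply/hV.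
      have [v' hv'] := rank_mem_ex hu zy; exists v' => //.
      exact: (ord_trans oa (rank_mem hu hv' zy) ua).
    rewrite hr; split=> [[wa [z [v [zx hz hw]]]]|[z [v [zx /fE[zt Fz] hw]]]].
      exists z, v; split=> //; have zV : z \In V by apply/hV; apply: xa.
      by apply/fE; split; [apply/ht; left|left].
    have [v' hv' v'a] := xa z zx; have zV : z \In V by apply/hV; exists v'.
    have ev : v = v' by apply: FU Fz _; left.
    rewrite {}ev in hw *; split; last by exists z, v'.
    by case: hw => [wv|->] //; exact: (ord_trans oa wv v'a).
  - by apply/fE; split; [apply/ht; right|right].
exists r => //; case: (ord_trichotomy (rank_ord hx) oa) => [|->|ar]; [by left|by right|].
by case: (@mem_irrefl a); have /hr[] := ar.
Qed.

Lemma rank_ordinal a : Ord a -> has_rank a a.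
Proof.
apply: (ord_ind (A := fun a => has_rank a a)) => [|{}a oa IH]; first by def_tac.
have [y ya|u hu ua] := rank_subset_level oa (x := a); first by exists y => //; apply: IH.
suff eu : u = a by rewrite eu in hu.
case: ua => // ua; case: (@mem_irrefl u).
by apply/(rankP hu); exists u, u; split=> //; [apply: IH|right].
Qed.

Lemma rank_le_mem s x u v : has_rank s u -> has_rank x v -> v \In u -> rank_le x s.
Proof. by move=> hs hx vu; exists v, u; split=> //; left. Qed.

Lemma rank_lt_mem a x y : Ord a -> rank_lt_ord x a -> y \In x -> rank_lt_ord y a.
Proof.
move=> oa [u hu ua] yx; have [v hv] := rank_mem_ex hu yx.
by exists v => //; apply: (ord_trans oa (rank_mem hu hv yx) ua).
Qed.

(** * Numerals *)

Lemma numeral_ex k : exists2 x, numeral k x & Ord x.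
Proof.
elim: k => [|k [x kx ox]].
  have [w [[e ew ee] _]] := ZF_infinity ZFM; exists e => //.
  by apply: ord_intro => [x /ee|x /ee].
have [y hy] := succ_ex x; exists y; [by exists x|exact: (ord_succ ox hy)].
Qed.

Definition num k : M := projT1 (cid (let: ex_intro2 x kx _ := numeral_ex k in ex_intro _ x kx)).
Lemma numP k : numeral k (num k).
Proof. by rewrite /num; case: cid. Qed.

Lemma numeralE k x : numeral k x <-> x = num k.
Proof.
split=> [|->]; last exact: numP.
move: (numP k); elim: k x (num k) => [|k IH] x y /=.
  by move=> ey ex; apply: ZF_extensionality => // z; split=> [/ex|/ey].
move=> [y' ky' sy] [x' kx' sx]; apply: ZF_extensionality => // z.
by rewrite (sx z) (sy z) (IH _ _ ky' kx').
Qed.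

Lemma num_ord k : Ord (num k).
Proof. by have [x /numeralE->] := numeral_ex k. Qed.

Lemma num_succ k : is_succ (num k.+1) (num k).
Proof. by have [y /numeralE-> h] := numP k.+1. Qed.

Lemma mem_num k x : x \In num k <-> exists2 l, l < k & x = num l.
Proof.
elim: k => [|k IH].
  by split=> [h|[//]]; have := numP 0 => /(_ x).
rewrite (num_succ k x) IH; split=> [[[l lk ->]|->]|[l]].
- by exists l => //; apply: ltnW.
- by exists k.
- by rewrite ltnS leq_eqVlt => /orP[/eqP->|lk] ->; [right|left; exists l].
Qed.

Lemma num_inj : injective num.
Proof.
move=> k l e; case: (ltngtP k l) => // h; case: (@mem_irrefl (num k)).
  by rewrite {2}e; apply/mem_num; exists k.
by rewrite {1}e; apply/mem_num; exists l.
Qed.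

(** The ordinals in an inductive set, together with their elements, form a
    transitive set of ordinals. *)
Lemma ord_omega_ex : exists2 o, Ord o & forall k, num k \In o.
Proof.
have [w [[e ew ee] hw]] := ZF_infinity ZFM.
have [a ha] : exists a, forall x, x \In a <-> x \In w /\ Ord x.
  by apply: separation; def_tac.
have [u hu] := ZF_union ZFM a; have [o ho] := cup_ex a u.
have oo x : x \In o -> Ord x.
  by move=> /ho[/ha[]//|/hu[y /ha[_ oy]]]; apply: ord_mem.
exists o.
  apply: ord_intro => // x /ho[xa y yx|/hu[y ya xy] z zx].
    by apply/ho; right; apply/hu; exists x.
  apply/ho; right; apply/hu; exists y => //.
  by have /ha[_ oy] := ya; apply: (ord_trans oy zx xy).
move=> k; apply/ho; left; apply/ha; split; last exact: num_ord.
elim: k => [|k /hw[y yw ys]].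
  by rewrite (_ : num 0 = e) //; apply/esym/numeralE.
rewrite (_ : num k.+1 = y) //; apply: ZF_extensionality => // z.
by rewrite (num_succ k z) (ys z).
Qed.

(** * Rank-initial topless classes *)

Section Cut.
Variable S : M -> Prop.
Hypotheses (initS : rank_initial S) (topS : omega_topless S).

Lemma cut_has_rank s : S s -> exists2 u, has_rank s u & S u.
Proof.
case: topS => -[a oa ha] _ Ss; have [u hu ua] := ha s Ss; exists u => //.
apply: initS Ss _; exists u, u; split=> //; last by right.
by apply/rank_ordinal/(ord_mem oa).
Qed.

Lemma cut_mem s x : S s -> x \In s -> S x.
Proof.
move=> Ss xs; have [u hu _] := cut_has_rank Ss; have [v hv] := rank_mem_ex hu xs.
apply: initS Ss _; exact: (rank_le_mem hu hv (rank_mem hu hv xs)).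
Qed.

Lemma cut_level a s : Ord a -> ~ S a -> S s -> rank_lt_ord s a.
Proof.
move=> oa nSa Ss; have [u hu Su] := cut_has_rank Ss; exists u => //.
case: (ord_trichotomy (rank_ord hu) oa) => // [e|au]; case: nSa; first by rewrite -e.
exact: (cut_mem Su au).
Qed.

Lemma cut_ord_lt a g : Ord a -> ~ S a -> Ord g -> S g -> g \In a.
Proof.
move=> oa nSa og Sg; case: (ord_trichotomy og oa) => // [e|ag]; case: nSa.
  by rewrite -e.
exact: (cut_mem Sg ag).
Qed.

Lemma cut_bound : exists2 a, Ord a & ~ S a.
Proof.
case: topS => -[a oa ha] _; exists a => // /ha[u hu ua]; apply: (@mem_irrefl a).
by rewrite {1}(rank_unique (rank_ordinal oa) hu).
Qed.

(** Toplessness applied to the constant function with value a.  So the ordinals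
    of S have no supremum, and S is closed under successors of ordinals. *)
Lemma cut_descent a : Ord a -> ~ S a -> exists2 b, Ord b /\ ~ S b & b \In a.
Proof.
move=> oa nSa; have [o oo omem] := ord_omega_ex.
have [c hc] := succ_ex a; have oc := ord_succ oa hc.
have [|x p p' _ /opairE-> /opairE-> //|f hf] := @replacement
  (fun x p => is_opair p x a) o; first by def_tac.
have fE x y : app f x y <-> x \In o /\ y = a.
  rewrite appE hf; split=> [[z zo /opairE/op_inj[-> ->]] //|[xo ->]].
  by exists x => //; apply: opP.
case: topS => _ /(_ f o c oo oc)[].
- split=> [p /hf[x xo hp]|x xo]; first by exists x, a; split=> //; apply/hc; right.
  by exists a; split=> [|y /fE[]//]; apply/fE.
- by move=> k x /numeralE->.
- by move=> k m [x _ /fE[_ ->]].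
- move=> b [ob nSb hb]; exists b => //; apply: (hb 0).
  by exists (num 0); [exact: numP|apply/fE].
Qed.

Lemma cut_succ a b : Ord a -> S a -> is_succ b a -> S b.
Proof.
move=> oa Sa hb; apply: contrapT => nSb.
have [c [_ nSc] /hb[ca|e]] := cut_descent (ord_succ oa hb) nSb; last by rewrite e in nSc.
exact: nSc (cut_mem Sa ca).
Qed.

(** Such a set has rank at most a, by [rank_subset_level]. *)
Lemma cut_subset a x : Ord a -> S a -> (forall y, y \In x -> rank_lt_ord y a) -> S x.
Proof.
move=> oa Sa xa; have [u hu ua] := rank_subset_level oa xa.
by apply: initS Sa _; exists u, a; split=> //; apply: rank_ordinal.
Qed.

Lemma cut_ord_num k : S (num k).
Proof.
elim: k => [|k IH]; last exact: (cut_succ (num_ord k) IH (num_succ k)).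
apply: contrapT => nS; have [b _] := cut_descent (num_ord 0) nS.
by have := numP 0 => /(_ b).
Qed.

Lemma cut_ord2 s t : S s -> S t -> exists a, [/\ Ord a, S a, rank_lt_ord s a & rank_lt_ord t a].
Proof.
move=> /cut_has_rank[u hu Su] /cut_has_rank[v hv Sv].
have [a [oa Sa ua va]] : exists a, [/\ Ord a, S a, u \In a \/ u = a & v \In a \/ v = a].
  case: (ord_trichotomy (rank_ord hu) (rank_ord hv)) => [uv|e|vu].
  - by exists v; split=> //; [exact: (rank_ord hv)|by left|by right].
  - by exists v; split=> //; [exact: (rank_ord hv)|by right|by right].
  - by exists u; split=> //; [exact: (rank_ord hu)|by right|by left].
have [b hb] := succ_ex a; exists b; split; first exact: (ord_succ oa hb).
- exact: (cut_succ oa Sa hb).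
- by exists u => //; apply/hb.
- by exists v => //; apply/hb.
Qed.

Lemma cut_upair z s t : S s -> S t -> is_upair z s t -> S z.
Proof.
move=> Ss St hz; have [a [oa Sa hs ht]] := cut_ord2 Ss St.
by apply: (cut_subset oa Sa) => y /hz[]->.
Qed.

Lemma cut_opair s t : S s -> S t -> S (op s t).
Proof.
move=> Ss St; have [x hx] := ZF_pairing ZFM s s; have [y hy] := ZF_pairing ZFM s t.
apply: (@cut_upair _ x y); [exact: (cut_upair Ss Ss hx)|exact: (cut_upair Ss St hy)|] => w.
rewrite (opP s t w); split=> -[h|h]; [left|right|left|right];
  by [apply: ZF_extensionality => // v; rewrite h ?hx ?hy|rewrite h].
Qed.

Lemma cut_level_mem a V : Ord a -> S a -> (forall x, x \In V <-> rank_lt_ord x a) -> S V.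
Proof. by move=> oa Sa hV; apply: (cut_subset oa Sa) => y /hV. Qed.

(** An ordered pair of elements of rank less than a has rank at most a + 1, so
    that the set is included in the level a + 2. *)
Lemma cut_pairs K V x : S V ->
  (forall p, p \In x -> exists k s, [/\ k < K, s \In V & p = op (num k) s]) ->
  S x.
Proof.
move=> SV hx; have SK := cut_ord_num K.
have [a [oa Sa hK hV]] := cut_ord2 SK SV.
have [b hb] := succ_ex a; have ob := ord_succ oa hb; have Sb := cut_succ oa Sa hb.
have [c hc] := succ_ex b; have oc := ord_succ ob hc; have Sc := cut_succ ob Sb hc.
have up z s t : rank_lt_ord s a -> rank_lt_ord t a -> is_upair z s t -> rank_lt_ord z b.
  move=> hs ht hz; have [u hu ua] : exists2 u, has_rank z u & u \In a \/ u = a.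
    by apply: rank_subset_level => // y /hz[]->.
  by exists u => //; apply/hb.
apply: (cut_subset oc Sc) => p /hx[k [s [ltk sV ->]]].
have hk : rank_lt_ord (num k) a by apply: rank_lt_mem hK _ => //; apply/mem_num; exists k.
have hs : rank_lt_ord s a by apply: rank_lt_mem hV sV.
have [u hu ub] : exists2 u, has_rank (op (num k) s) u & u \In b \/ u = b.
  by apply: rank_subset_level => // y /(opP _ _ y)[]; [apply: (up y (num k) (num k))|apply: (up y (num k) s)].
by exists u => //; apply/hc.
Qed.

End Cut.

End ZFTheory.

(** * Coding definable sets by elements *)

Lemma ufam_mfam (M : structure) Q k : ufam Q -> mfam (fun e => Q k M e).
Proof.
case=> n [phi [_ h]].
exists n, (fun=> subst (phi k) (fun i => Var M i) (of_void _)); split; first exact: rfun_const.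
by move=> _ _ e; rewrite -h; apply: sat_subst => // -[].
Qed.

Lemma ufam_index Q k : ufam Q -> ufam (fun _ => Q k).
Proof.
by case=> n [phi [_ h]]; exists n, (fun=> phi k); split=> //; apply: rfun_const.
Qed.

Lemma truthE (M : structure) (phi : L0 1) (z : M) : truth (godel phi) z <-> sat0 phi [tuple z].
Proof. by split=> [[psi /godel_inj->]|h] //; exists phi. Qed.

Section Coding.
Variables (M : structure) (ZFM : ZF M) (satM : recursively_saturated M).
Notation op := (op ZFM).
Notation num := (num ZFM).

(** The conditions on c for all standard k form a recursive type.  For k < K
    they are met by a set that contains only pairs with first component less
    than K; this makes room for the induction on K. *)
Lemma coding_lemma (Psi : nat -> forall M : structure, M -> Prop) (V b : M) :
  ufam (fun k M e => Psi k M (e 0)) ->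
  exists c, forall k s, s \In V -> (op (num k) s \In c <-> Psi k M (op s b)).
Proof.
move=> fPsi.
pose Q k (M : structure) (e : nat -> M) := forall s i p z, s \In e 1 -> numeral k i ->
  is_opair p i s -> is_opair z s (e 2) -> (p \In e 0 <-> Psi k M z).
have fQ : ufam Q.
  by rewrite /ufam /Q; fam_tac; [exact: fam_numeral|].
have [|c hc] := uniform_saturation (e := scons V (fun=> b)) satM fQ; last first.
  by exists c => k s sV; apply: (hc k s (num k)) => //; [exact: numP|exact: opP|exact: opP].
move=> K; suff [c hc] : exists c, forall k s, s \In V ->
    (op (num k) s \In c <-> k < K /\ Psi k M (op s b)).
  exists c => k ltk s i p z sV /(numeralE ZFM)-> /(opairE ZFM)-> /(opairE ZFM)->.
  by rewrite (hc k s sV); split=> [[]|].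
elim: K => [|K [c hc]].
  have [c hc] : exists c, forall x, x \In c <-> x \In V /\ False.
    by apply: (separation ZFM (A := fun=> False)); def_tac.
  by exists c => k s _; split=> [/hc[]|[]].
have fK : mfam (fun e => Psi K M (e 0)) by apply: (ufam_mfam M K fPsi).
have [|s p p' _ [z _ /(opairE ZFM)->] [z' _ /(opairE ZFM)->] //|a ha] :=
  @replacement _ ZFM (fun s p => exists2 z, is_opair z s b /\ Psi K M z & is_opair p (num K) s) V.
  by def_tac.
have [d hd] := cup_ex ZFM c a; exists d => k s sV; rewrite hd (hc k s sV) ha.
split=> [[[ltk h]|[s' s'V [z [/(opairE ZFM)-> h] /(opairE ZFM)/op_inj[/num_inj-> ->]]]]|].
- by split=> //; apply: ltnW.
- by [].
- rewrite ltnS leq_eqVlt => -[/orP[/eqP->|ltk] h]; last by left.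
  by right; exists s => //; exists (op s b); [split=> //; exact: opP|exact: opP].
Qed.

End Coding.

(** Formulas with bounded quantifiers mean the same in a structure and in a
    transitive substructure.  This is applied to the definitions of pairs and
    numerals, so that both models compute them alike on S. *)
Section Absoluteness.
Variables (S M : structure) (j : S -> M).
Hypotheses (emb : embedding j) (tr : forall s x, x \In j s -> exists y, x = j y).

Lemma upair_abs z x y : is_upair (j z) (j x) (j y) <-> is_upair z x y.
Proof.
have [inj mem] := emb; split=> h w; first by rewrite mem (h (j w)); split=> -[] => [/inj|/inj|->|->]; auto.
split=> [wz|].
  have [v ev] := tr wz; move: wz; rewrite ev -mem => /h[->|->]; auto.
by case=> ->; rewrite -mem; apply/h; auto.
Qed.

Lemma opair_abs p x y : (forall z, is_upair z (j x) (j x) \/ is_upair z (j x) (j y) ->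
    exists v, z = j v) -> is_opair (j p) (j x) (j y) <-> is_opair p x y.
Proof.
have [inj mem] := emb; move=> hz; split=> h w.
  by rewrite mem (h (j w)) !upair_abs.
split=> [wp|hw].
  by have [v ev] := tr wp; move: wp; rewrite ev -mem !upair_abs => /h.
by have [v ev] := hz w hw; move: hw; rewrite ev -mem !upair_abs => /h.
Qed.

Lemma numeral_abs k x : numeral k (j x) <-> numeral k x.
Proof.
have [inj mem] := emb; elim: k x => [|k IH] x /=.
  split=> h y; first by rewrite mem.
  by move=> yx; have [v ev] := tr yx; move: yx; rewrite ev -mem => /h.
have sE y : is_succ (j x) (j y) <-> is_succ x y.
  split=> h z.
    by rewrite !mem (h (j z)); split=> -[] => [|/inj||->]; auto.
  split=> [zx|].
    by have [v ev] := tr zx; move: zx; rewrite ev -!mem => /h[|->]; auto.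
  case=> [zy|->]; last by rewrite -mem; apply/h; right.
  by have [v ev] := tr zy; move: zy; rewrite ev -!mem => vy; apply/h; left.
split=> [[y ky sy]|[y ky sy]]; last by exists (j y); [apply/IH|apply/sE].
have [v ev] : exists v, y = j v by apply: (tr (s := x)); apply/sy; right.
by rewrite ev in ky sy; exists v; [apply/IH|apply/sE].
Qed.
End Absoluteness.

(** * Elements of the same type over S *)

(** Pairs and numerals are quantified universally to keep the expression first
    order; [decided_byE] gives the meaning in models of set theory. *)
Definition decided_by k (M : structure) (s q d : M) := forall i p t,
  numeral k i -> is_opair p i s -> is_opair t s q -> (truth k t <-> p \In d).

Lemma decided_byE (M : structure) (ZFM : ZF M) k (s q d : M) :
  decided_by k s q d <-> (truth k (op ZFM s q) <-> op ZFM (num ZFM k) s \In d).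
Proof.
split=> [h|h i p t /(numeralE ZFM)-> /(opairE ZFM)-> /(opairE ZFM)-> //].
by apply: h; [exact: numP|exact: opP|exact: opP].
Qed.

Section Common.
Variables (M N S : structure) (jM : S -> M) (jN : S -> N).
Hypotheses (ZFM : ZF M) (ZFN : ZF N).

(** One parameter s, one element and unary formulas are enough, since finitely
    many elements can be packed into one by pairing. *)
Definition same_type (m : M) (n : N) := forall (phi : L0 1) (s : S),
  sat0 phi [tuple op ZFM (jM s) m] <-> sat0 phi [tuple op ZFN (jN s) n].

Lemma same_type_transfer (Psi : forall M : structure, M -> Prop) m n s :
  ufam (fun _ M e => Psi M (e 0)) -> same_type m n ->
  (Psi M (op ZFM (jM s) m) <-> Psi N (op ZFN (jN s) n)).
Proof.
case=> k [phi [_ h]] E.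
have hs (L : structure) (z : L) :
    sat0 (subst (phi 0) (fun=> Var void ord0) (of_void _)) [tuple z] <-> Psi L z.
  rewrite -(h 0 L (fun=> z)); apply: sat_subst => [i|[]] //.
  by rewrite tnth_mktuple.
by rewrite -!hs; apply: E.
Qed.
End Common.

Lemma same_type_sym (M N S : structure) (jM : S -> M) (jN : S -> N) (ZFM : ZF M) (ZFN : ZF N) m n :
  same_type jM jN ZFM ZFN m n -> same_type jN jM ZFN ZFM n m.
Proof. by move=> h phi s; rewrite h. Qed.

Section RangeOfS.
Variables (S M : structure) (j : S -> M) (ZFM : ZF M).
Hypotheses (emb : embedding j) (iS : rank_initial (range j)) (tS : omega_topless (range j)).

Lemma range_trans s x : x \In j s -> exists y, x = j y.
Proof. by move=> xs; have [|y _ <-] := cut_mem ZFM iS tS _ xs; [exists s|exists y]. Qed.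

Lemma range_opair a b : exists p, j p = op ZFM (j a) (j b).
Proof.
by have [||p _ ep] := cut_opair ZFM iS tS (s := j a) (t := j b);
  [exists a|exists b|exists p].
Qed.

Lemma range_num k : exists p, j p = num ZFM k.
Proof. by have [p _ ep] := cut_ord_num ZFM iS tS k; exists p. Qed.

Lemma range_opairE p a b : j p = op ZFM (j a) (j b) <-> is_opair p a b.
Proof.
rewrite -opairE; apply: opair_abs => // [|z hz]; first exact: range_trans.
have h : forall c, range j (j c) by move=> c; exists c.
have [v _ <-] : range j z by case: hz; apply: (cut_upair ZFM iS tS).
by exists v.
Qed.

Lemma range_numE k p : j p = num ZFM k <-> numeral k p.
Proof. by rewrite -numeralE; apply: numeral_abs => // ; apply: range_trans. Qed.
End RangeOfS.

(** * Extending a pair of elements of the same type *)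

Section Step.
Variables (M N S : structure) (jM : S -> M) (jN : S -> N).
Hypotheses (ZFM : ZF M) (ZFN : ZF N).
Hypotheses (satM : recursively_saturated M) (satN : recursively_saturated N).
Hypotheses (subM : embedding jM) (subN : embedding jN).
Hypotheses (initM : rank_initial (range jM)) (initN : rank_initial (range jN)).
Hypotheses (topM : omega_topless (range jM)) (topN : omega_topless (range jN)).
Hypothesis codMN : Cod jM = Cod jN.

Local Notation opM := (op ZFM).
Local Notation opN := (op ZFN).
Local Notation numM := (num ZFM).
Local Notation numN := (num ZFN).
Local Notation same := (same_type jM jN ZFM ZFN).

Lemma common_opair a b : exists p, jM p = opM (jM a) (jM b) /\ jN p = opN (jN a) (jN b).
Proof.
have [p hp] := range_opair ZFM initM topM a b; exists p; split=> //.
by apply/(range_opairE ZFN subN initN topN)/(range_opairE ZFM subM initM topM).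
Qed.

Lemma common_num k : exists p, jM p = numM k /\ jN p = numN k.
Proof.
have [p hp] := range_num ZFM initM topM k; exists p; split=> //.
by apply/(range_numE ZFN subN initN topN)/(range_numE ZFM subM initM topM).
Qed.

Lemma common_indexed k s : exists p, jM p = opM (numM k) (jM s) /\ jN p = opN (numN k) (jN s).
Proof.
have [i [<- <-]] := common_num k; exact: common_opair.
Qed.

(** The arguments g, n and d are packed into z, because families to be coded by
    an element consist of unary predicates. *)
Definition decidable_below K (L : structure) (z : L) := forall g w n d,
  is_opair z g w -> is_opair w n d -> exists y q, is_opair q n y /\
  forall s, rank_lt_ord s g -> forall k, k < K -> decided_by k s q d.

(** The analogue of [decidable_below] with a set v of elements in place of the
    elements of rank less than g.  Applied to v and d in S it is a statement
    about one element of S, so that it can be transferred between the models. *)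
Definition decidable_on K (L : structure) (z : L) := forall u n v d,
  is_opair z u n -> is_opair u v d -> exists y q, is_opair q n y /\
  forall s, s \In v -> forall k, k < K -> decided_by k s q d.

Lemma ufam_decided_by i j l : ufam (fun k L e => decided_by k (e i) (e j) (e l)).
Proof. by rewrite /decided_by /ufam; fam_tac; [exact: fam_numeral|exact: ufam_truth]. Qed.

Lemma ufam_decidable_below : ufam (fun K L e => decidable_below K (e 0)).
Proof.
rewrite /decidable_below /ufam; fam_tac.
by apply: fam_forall_lt; apply: ufam_decided_by.
Qed.

Lemma ufam_decidable_on : ufam (fun K L e => decidable_on K (e 0)).
Proof.
rewrite /decidable_on /ufam; fam_tac.
by apply: fam_forall_lt; apply: ufam_decided_by.
Qed.

(** In M, the type of the pair of m and x over some level that includes S is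
    coded by an element c; its trace on S is also coded in N.  The pairs of
    numerals and elements of S belong to S, and both models agree on them. *)
Lemma type_code m x : exists d : N, forall k s,
  truth k (opM (jM s) (opM m x)) <-> opN (numN k) (jN s) \In d.
Proof.
have [a oa nSa] := cut_bound ZFM topM; have [V hV] := level_ex ZFM oa.
have [c hc] := coding_lemma ZFM satM V (opM m x) ufam_truth.
have : Cod jN [set p | jM p \In c] by rewrite -codMN; exists c.
case=> d hd; exists d => k s; have [p [hpM hpN]] := common_indexed k s.
have -> : opN (numN k) (jN s) \In d <-> jM p \In c.
  rewrite -hpN; have e : [set p | jM p \In c] p = (jN p \In d) by rewrite hd.
  by rewrite -e.
by rewrite hpM hc //; apply/hV/(cut_level ZFM initM topM) => //; exists s.
Qed.

(** Let d be given by [type_code].  For each standard K, and each ordinal g in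
    S, the statement P K g holds: there is y such that d codes the first K
    formulas of the type of the pair of n and y, over the elements of rank less
    than g.  Indeed the level g and the relevant part of d belong to S, hence
    the existence of y is expressed by a formula with a parameter from S, which
    is true in M because of x.  The ordinals up to which P K holds throughout
    form an ordinal outside S, as it would otherwise be an element of itself.
    The sequence of these ordinals for standard K is part of an internal
    function f by the coding lemma.  Toplessness yields an ordinal nu outside S
    that is smaller than all of them, thus satisfies P K for all standard K, and
    a final use of saturation gives one y that works for all K.  As S is
    included in the level nu, this y is as desired. *)
Lemma same_type_extend m n x : same m n -> exists y, same (opM m x) (opN n y).
Proof.
move=> E; have [d hd] := type_code m x.
pose P K g := exists y, forall s, rank_lt_ord s g -> forall k, k < K ->
  (truth k (opN s (opN n y)) <-> opN (numN k) s \In d).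
have PE K g : decidable_below K (opN g (opN n d)) <-> P K g.
  split=> [h|[y hy]].
    have [y [q [/(opairE ZFN)-> hy]]] := h _ _ _ _ (opP _ _ _) (opP _ _ _).
    by exists y => s sg k ltk; apply/decided_byE/hy.
  move=> g' w n' d' /(opairE ZFN)/op_inj[<- <-] /(opairE ZFN)/op_inj[<- <-].
  exists y, (opN n y); split; first exact: opP.
  by move=> s sg k ltk; apply/(decided_byE ZFN)/hy.
have PS K g : ordinal_of g -> range jN g -> P K g.
  move=> og Sg; have [V' hV'] := level_ex ZFN og.
  have [v _ ev] := cut_level_mem ZFN initN og Sg hV'.
  have [e he] : exists e, forall p, p \In e <-> p \In d /\
      exists i s, [/\ i \In numN K, s \In V' & is_opair p i s].
    by apply: (separation ZFN); def_tac.
  have [h _ eh] : range jN e.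
    have SV' : range jN V' by exists v.
    apply: (@cut_pairs _ ZFN _ initN topN K V') => //.
    move=> p /he[_ [i [s [/(mem_num ZFN)[k ltk ->] sV /(opairE ZFN)->]]]].
    by exists k, s.
  have [u [huM huN]] := common_opair v h.
  have heE k s : k < K -> s \In V' -> (opN (numN k) s \In e <-> opN (numN k) s \In d).
    move=> ltk sV; rewrite he; split=> [[]//|hh]; split=> //.
    by exists (numN k), s; split=> //; [apply/mem_num; exists k|exact: opP].
  have onM : decidable_on K (opM (jM u) m).
    move=> u' m' v' h' /(opairE ZFM)/op_inj[<- <-]; rewrite huM => /(opairE ZFM)/op_inj[<- <-].
    exists x, (opM m x); split; first exact: opP.
    move=> s sv k ltk; apply/(decided_byE ZFM).
    have [s' es] := range_trans ZFM initM topM sv; rewrite {s}es in sv *.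
    rewrite hd -heE //; last by rewrite -ev; apply/subN.2/subM.2.
    have [p [<- <-]] := common_indexed k s'.
    by rewrite -eh -subN.2 -subM.2.
  have onN := (same_type_transfer u (ufam_index K ufam_decidable_on) E).1 onM.
  have [y [q [/(opairE ZFN)-> hy]]] := onN _ _ _ _ (opP _ _ _) (proj2 (opairE _ _ _ _) huN).
  exists y => s /hV' sV k ltk; rewrite -heE // -eh.
  by apply/decided_byE/hy => //; rewrite ev.
have [a oa nSa] := cut_bound ZFN topN; have [a' ha'] := succ_ex ZFN a.
have oa' := ord_succ ZFN oa ha'.
have [c hc] := coding_lemma ZFN satN a (opN n d) ufam_decidable_below.
have [o oo omem] := ord_omega_ex ZFN.
(* G i g says that g is the largest initial segment of a on which c gives the
   value true at index i.  It is an ordinal also for nonstandard i, as is needed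
   for f to take values in an ordinal. *)
pose G i g := forall y, y \In g <-> y \In a /\
  forall z, z \In y \/ z = y -> exists2 r, is_opair r i z & r \In c.
have Gord i g : G i g -> ordinal_of g.
  move=> hg; apply: (ord_intro ZFN) => [y /hg[ya yc] z zy|y /hg[ya _]]; last exact: (ord_mem oa ya).
  apply/hg; split; first exact: (ord_trans oa zy ya).
  move=> w wz; apply: yc; left; case: wz => [wz|-> //].
  exact: (ord_trans (ord_mem oa ya) wz zy).
have [|i p p' _ [g hg /(opairE ZFN)->] [g' hg' /(opairE ZFN)->]|f hf] := @replacement _ ZFN
    (fun i p => exists2 g, G i g & is_opair p i g) o.
- by rewrite /G; def_tac.
- by congr opN; apply: (ZF_extensionality ZFN) => y; rewrite (hg y) (hg' y).
have fE i g : app f i g <-> i \In o /\ G i g.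
  rewrite appE hf; split=> [[i' io [g' hg' /(opairE ZFN)/op_inj[-> ->]]] //|[io hg]].
  by exists i => //; exists g => //; exact: opP.
have Ga' i g : G i g -> g \In a'.
  move=> hg; apply/ha'; case: (ord_trichotomy ZFN (Gord _ _ hg) oa) => [|->|ag]; [by left|by right|].
  by have /hg[/(mem_irrefl ZFN)] := ag.
have funf : Defs.is_fun f o a'.
  split=> [p /hf[i io [g hg pig]]|i io].
    by exists i, g; split=> //; apply: Ga' hg.
  have [g hg] : exists g, G i g by apply: (separation ZFN); def_tac.
  exists g; split=> [|g' /fE[_ hg']]; first exact/fE.
  by apply: (ZF_extensionality ZFN) => y; rewrite (hg y) (hg' y).
have outf k g : value_at f k g -> ordinal_of g /\ ~ range jN g.
  move=> [i /(numeralE ZFN)-> /fE[_ hg]]; split; first exact: Gord hg.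
  (* If g were in S, then g itself and all smaller ordinals would satisfy P k. *)
  move=> Sg; have og := Gord _ _ hg; apply: (mem_irrefl ZFN (x := g)); apply/hg.
  have ga b : ordinal_of b -> range jN b -> b \In a by apply: (cut_ord_lt ZFN initN topN).
  split; first exact: ga.
  move=> z zg; have [oz Sz] : ordinal_of z /\ range jN z.
    by case: zg => [zg|->//]; split; [apply: (ord_mem og zg)|apply: (cut_mem ZFN initN topN Sg zg)].
  exists (opN (numN k) z); first exact: opP.
  by apply/hc; [exact: ga|apply/PE/PS].
case: topN => _ /(_ f o a' oo oa' funf)[k i /(numeralE ZFN)-> //|//|nu [onu nSnu hnu]].
have Pnu K : P K nu.
  have [g hg] : exists g, app f (numN K) g by apply: fun_total funf (omem K).
  have /fE[_ hG] := hg; have : nu \In g by apply: (hnu K); exists (numN K) => //; exact: numP.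
  move=> /hG[nua /(_ nu (or_intror erefl))[r /(opairE ZFN)-> hr]].
  by apply/PE/hc.
pose Q k (L : structure) (e : nat -> L) := forall q, is_opair q (e 2) (e 0) ->
  forall s, rank_lt_ord s (e 1) -> decided_by k s q (e 3).
have fQ : ufam Q by rewrite /ufam /Q; fam_tac; exact: ufam_decided_by.
have [|y hy] := uniform_saturation (e := scons nu (scons n (fun=> d))) satN fQ.
  move=> K; have [y hy] := Pnu K; exists y => k ltk q /(opairE ZFN)-> s snu.
  by apply/(decided_byE ZFN)/hy.
exists y => phi s; rewrite -!truthE hd.
have snu : rank_lt_ord (jN s) nu by apply: (cut_level ZFN initN topN) => //; exists s.
by have /decided_byE-> := hy (godel phi) (opN n y) (opP _ _ _) (jN s) snu.
Qed.
End Step.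

(** * Tuples of elements, packed by pairing *)

Section SameType.
Variables (M N S : structure) (jM : S -> M) (jN : S -> N).
Hypotheses (ZFM : ZF M) (ZFN : ZF N).
Local Notation opM := (op ZFM).
Local Notation opN := (op ZFN).
Local Notation same := (same_type jM jN ZFM ZFN).

(** Elements defined in the same way from elements of the same type have the same
    type.  The hypothesis on F allows it to be used at any two variables. *)
Lemma same_type_def (F : forall L : structure, L -> L -> Prop) m n u v :
  (forall i j, ufam (fun _ L e => F L (e i) (e j))) ->
  (forall x, F M m x <-> x = u) -> (forall y, F N n y <-> y = v) ->
  same m n -> same u v.
Proof.
move=> fF hM hN E phi s.
pose Psi (L : structure) (z : L) := exists s m u t,
  [/\ is_opair z s m, F L m u, is_opair t s u & truth (godel phi) t].
have fPsi : ufam (fun _ L e => Psi L (e 0)).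
  rewrite /ufam /Psi; fam_tac; first exact: fF.
  exact: (ufam_index (godel phi) ufam_truth).
have PsiE L (ZFL : ZF L) s' m' u' : (forall x, F L m' x <-> x = u') ->
    Psi L (op ZFL s' m') <-> sat0 phi [tuple op ZFL s' u'].
  move=> h; rewrite -truthE; split.
    by move=> [s1 [m1 [u1 [t [/(opairE ZFL)/op_inj[<- <-] /h-> /(opairE ZFL)-> //]]]]].
  by exists s', m', u', (op ZFL s' u'); split=> //; [exact: opP|exact/h|exact: opP].
by rewrite -(PsiE _ ZFM _ _ _ hM) -(PsiE _ ZFN _ _ _ hN); apply: same_type_transfer.
Qed.

Lemma same_type_diag m n : same m n -> same (opM m m) (opN n n).
Proof.
apply: (@same_type_def (fun L m x => is_opair x m m)).
- by move=> i j; rewrite /ufam; fam_tac.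
- by move=> x; apply: opairE.
- by move=> x; apply: opairE.
Qed.

Lemma same_type_swap a b w x : same (opM a w) (opN b x) -> same (opM w a) (opN x b).
Proof.
have hF L (ZFL : ZF L) a' w' x' :
    (exists a w, is_opair (op ZFL a' w') a w /\ is_opair x' w a) <-> x' = op ZFL w' a'.
  split=> [[a1 [w1 [/(opairE ZFL)/op_inj[<- <-] /(opairE ZFL)->]]] //|->].
  by exists a', w'; split; exact: opP.
apply: (@same_type_def (fun L m x => exists a w, is_opair m a w /\ is_opair x w a)).
- by move=> i j; rewrite /ufam; fam_tac.
- by move=> y; apply: hF.
- by move=> y; apply: hF.
Qed.

Lemma same_type_drop_head m n a b w x :
  same (opM (opM m a) w) (opN (opN n b) x) -> same (opM m w) (opN n x).
Proof.
have hF L (ZFL : ZF L) m' a' w' x' :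
    (exists c m a w, [/\ is_opair (op ZFL (op ZFL m' a') w') c w, is_opair c m a & is_opair x' m w])
    <-> x' = op ZFL m' w'.
  split=> [[c [m1 [a1 [w1 [/(opairE ZFL)/op_inj[<- <-] /(opairE ZFL)/op_inj[<- _] /(opairE ZFL)->]]]]] //|->].
  by exists (op ZFL m' a'), m', a', w'; split; exact: opP.
apply: (@same_type_def (fun L m x => exists c n a w,
  [/\ is_opair m c w, is_opair c n a & is_opair x n w])).
- by move=> i j; rewrite /ufam; fam_tac.
- by move=> y; apply: hF.
- by move=> y; apply: hF.
Qed.

Lemma same_type_head m n a b w x :
  same (opM (opM m a) w) (opN (opN n b) x) -> same (opM a w) (opN b x).
Proof.
have hF L (ZFL : ZF L) m' a' w' x' :
    (exists c m a w, [/\ is_opair (op ZFL (op ZFL m' a') w') c w, is_opair c m a & is_opair x' a w])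
    <-> x' = op ZFL a' w'.
  split=> [[c [m1 [a1 [w1 [/(opairE ZFL)/op_inj[<- <-] /(opairE ZFL)/op_inj[_ <-] /(opairE ZFL)->]]]]] //|->].
  by exists (op ZFL m' a'), m', a', w'; split; exact: opP.
apply: (@same_type_def (fun L m x => exists c n a w,
  [/\ is_opair m c w, is_opair c n a & is_opair x a w])).
- by move=> i j; rewrite /ufam; fam_tac.
- by move=> y; apply: hF.
- by move=> y; apply: hF.
Qed.

(** A unary formula at the pair of s and m is a sentence about the constants for s
    and m; all variables other than the first stand for m. *)
Lemma same_type_Th m n : Th jM m = Th jN n -> same m n.
Proof.
move=> eTh phi s.
pose Psi (L : structure) (e : nat -> L) := exists z, is_opair z (e 0) (e 1) /\ truth (godel phi) z.
have fPsi : ufam (fun _ L e => Psi L e).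
  by rewrite /ufam /Psi; fam_tac; exact: (ufam_index (godel phi) ufam_truth).
have [k [chi [_ h]]] := fPsi.
pose sigma (i : 'I_k) : term (option S) 0 := Cst 0 (if i == 0 :> nat then Some s else None).
pose psi := subst (chi 0) sigma (of_void _).
have hpsi L (ZFL : ZF L) (j : S -> L) (l : L) :
    Th j l psi <-> sat0 phi [tuple op ZFL (j s) l].
  have : Psi L (scons (j s) (fun=> l)) <-> sat0 phi [tuple op ZFL (j s) l].
    rewrite -truthE; split=> [[z [/(opairE ZFL)-> //]]|hz].
    by exists (op ZFL (j s) l); split=> //; exact: opP.
  move=> <-; rewrite -(h 0); apply: sat_subst => [i|[]] //=.
  by rewrite tnth_mktuple; case: (i : nat).
by rewrite -(hpsi _ ZFM) -(hpsi _ ZFN) eTh.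
Qed.

Variables (m0 : M) (n0 : N).
(** A finite partial map, given by the list of its pairs, is represented by one
    element on each side. *)
Definition codeM (l : seq (M * N)) := foldr (fun ab m => opM m ab.1) m0 l.
Definition codeN (l : seq (M * N)) := foldr (fun ab n => opN n ab.2) n0 l.
Definition matched l := same (codeM l) (codeN l).

Lemma matched_base l w x : same (opM (codeM l) w) (opN (codeN l) x) -> same (opM m0 w) (opN n0 x).
Proof. by elim: l => //= -[a b] l IH /same_type_drop_head. Qed.

(** Every entry of a list is definable from the code of the list.  The side
    component w makes the statement inductive and allows it to be used twice. *)
Lemma matched_mem l a b w x : List.In (a, b) l ->
  same (opM (codeM l) w) (opN (codeN l) x) -> same (opM a w) (opN b x).
Proof.
elim: l => //= -[a' b'] l IH [[<- <-]|abl]; first by move=> /same_type_head.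
by move=> /same_type_drop_head; apply: IH.
Qed.

Lemma matched_pair l a b c d : matched l -> List.In (a, b) l -> List.In (c, d) l ->
  same (opM a c) (opN b d).
Proof.
move=> gl abl cdl; apply/same_type_swap/(matched_mem cdl)/same_type_swap/(matched_mem abl).
exact: same_type_diag.
Qed.

Lemma matched_base_pair l a b : matched l -> List.In (a, b) l -> same (opM m0 a) (opN n0 b).
Proof.
move=> gl abl; apply/(@matched_base l)/same_type_swap/(matched_mem abl); exact: same_type_diag.
Qed.

Lemma same_type_mem a b c d (s : S) : same (opM a c) (opN b d) -> (a \In c <-> b \In d).
Proof.
move=> E; pose Psi (L : structure) (z : L) := exists s w a c,
  [/\ is_opair z s w, is_opair w a c & a \In c].
have PsiE L (ZFL : ZF L) s' a' c' : Psi L (op ZFL s' (op ZFL a' c')) <-> a' \In c'.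
  split=> [[s1 [w1 [a1 [c1 [/(opairE ZFL)/op_inj[_ <-] /(opairE ZFL)/op_inj[<- <-]]]]]] //|h].
  by exists s', (op ZFL a' c'), a', c'; split=> //; exact: opP.
rewrite -(PsiE _ ZFM (jM s)) -(PsiE _ ZFN (jN s)); apply: same_type_transfer => //.
by rewrite /ufam /Psi; fam_tac.
Qed.

Lemma same_type_eq a b c d (s : S) : same (opM a c) (opN b d) -> (a = c <-> b = d).
Proof.
move=> E; pose Psi (L : structure) (z : L) := exists s w a c,
  [/\ is_opair z s w, is_opair w a c & a = c].
have PsiE L (ZFL : ZF L) s' a' c' : Psi L (op ZFL s' (op ZFL a' c')) <-> a' = c'.
  split=> [[s1 [w1 [a1 [c1 [/(opairE ZFL)/op_inj[_ <-] /(opairE ZFL)/op_inj[<- <-]]]]]] //|h].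
  by exists s', (op ZFL a' c'), a', c'; split=> //; exact: opP.
rewrite -(PsiE _ ZFM (jM s)) -(PsiE _ ZFN (jN s)); apply: same_type_transfer => //.
by rewrite /ufam /Psi; fam_tac.
Qed.

Lemma same_type_param a b c d (s : S) : same (opM a c) (opN b d) -> (a = jM s <-> b = jN s).
Proof.
move=> E; pose Psi (L : structure) (z : L) := exists w a c, is_opair z a w /\ is_opair w a c.
have PsiE L (ZFL : ZF L) s' a' c' : Psi L (op ZFL s' (op ZFL a' c')) <-> a' = s'.
  split=> [[w1 [a1 [c1 [/(opairE ZFL)/op_inj[<- <-] /(opairE ZFL)/op_inj[<- _]]]]] //|->].
  by exists (op ZFL s' c'), s', c'; split=> //; exact: opP.
rewrite -(PsiE _ ZFM (jM s)) -(PsiE _ ZFN (jN s)); apply: same_type_transfer => //.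
by rewrite /ufam /Psi; fam_tac.
Qed.
End SameType.

(** * Back and forth *)

Lemma sat_isomorphism C (M N : structure) (I : C -> M) (i : M -> N) n (phi : form C n) v :
  isomorphism i -> sat I phi v <-> sat (i \o I) phi (map_tuple i v).
Proof.
move=> [bi mi]; have inj := bij_inj bi; have [k kK iK] := bi.
have ev n' (t : term C n') v' : eval (i \o I) (map_tuple i v') t = i (eval I v' t).
  by case: t => [j|c] //=; rewrite tnth_map.
elim: phi v => {n} //= [n t u|n t u|n p IHp q IHq|n p IHp] v.
- by rewrite !ev.
- by rewrite !ev; split=> [->//|/inj].
- by rewrite IHp IHq.
- have e a : [tuple of i a :: map_tuple i v] = map_tuple i [tuple of a :: v] by apply: val_inj.
  split=> h a; last by apply/IHp; rewrite -e.
  by rewrite -(iK a) e -IHp.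
Qed.

Theorem theorem7p14 (M N S : structure) (jM : S -> M) (jN : S -> N)
  (ZFM : ZF M) (ZFN : ZF N)
  (countM : countable [set: M]) (countN : countable [set: N])
  (satM : recursively_saturated M) (satN : recursively_saturated N)
  (subM : embedding jM) (subN : embedding jN)
  (initM : rank_initial (range jM)) (initN : rank_initial (range jN))
  (topM : omega_topless (range jM)) (topN : omega_topless (range jN))
  (m0 : M) (n0 : N) :
  (exists i : M -> N,
     [/\ isomorphism i, forall s : S, i (jM s) = jN s & i m0 = n0]) <->
  (SSy jM = SSy jN /\ Th jM m0 = Th jN n0).
Proof.
split=> [[i [iso fixS im0]]|[eSSy eTh]].
  have [bi mi] := iso; have [k kK iK] := bi; split.
    congr pair; apply/seteqP; split=> A [c ->].
      by exists (i c); apply/seteqP; split=> x /=; rewrite -fixS -mi.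
    by exists (k c); apply/seteqP; split=> x /=; rewrite mi fixS iK.
  have eI : i \o oapp jM m0 = oapp jN n0 by apply/funext => -[s|] /=.
  apply/seteqP; split=> phi; rewrite /Th /= (sat_isomorphism _ _ _ iso) eI;
    by rewrite (_ : map_tuple i [tuple] = [tuple]) //; apply: val_inj.
have codMN : Cod jM = Cod jN by case: eSSy.
pose G := matched jM jN ZFM ZFN m0 n0.
have forthG l a : G l -> exists b, G ((a, b) :: l).
  by move=> gl; have := same_type_extend satM satN subM subN initM initN topM topN codMN a gl.
have backG l b : G l -> exists a, G ((a, b) :: l).
  move=> gl; have [a ha] := same_type_extend satN satM subN subM initN initM topN topM (esym codMN) b
    (same_type_sym gl).
  by exists a; apply: same_type_sym.
have [s0 _] : exists s : S, True.
  by have [s _] := common_num ZFM ZFN subM subN initM initN topM topN 0; exists s.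
(* Stage k of the construction takes care of the elements numbered k in M
   and in N, if there are any. *)
have [cM injM] : exists c : M -> nat, injective c.
  by have /countable_injP[c hc] := countM; exists c => x y; apply: hc; rewrite inE.
have [cN injN] : exists c : N -> nat, injective c.
  by have /countable_injP[c hc] := countN; exists c => x y; apply: hc; rewrite inE.
have stepM k l : G l -> exists2 l', G l' & List.incl l l' /\
    forall a, cM a = k -> exists b, List.In (a, b) l'.
  move=> gl; have [[a ea]|no] := pselect (exists a, cM a = k); last first.
    by exists l => //; split=> [x //|a ea]; case: no; exists a.
  have [b gb] := forthG l a gl; exists ((a, b) :: l) => //; split=> [x xl|a' ea']; first by right.
  by exists b; left; congr pair; apply: injM; rewrite ea ea'.
have stepN k l : G l -> exists2 l', G l' & List.incl l l' /\
    forall b, cN b = k -> exists a, List.In (a, b) l'.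
  move=> gl; have [[b eb]|no] := pselect (exists b, cN b = k); last first.
    by exists l => //; split=> [x //|b eb]; case: no; exists b.
  have [a ga] := backG l b gl; exists ((a, b) :: l) => //; split=> [x xl|b' eb']; first by right.
  by exists a; left; congr pair; apply: injN; rewrite eb eb'.
have /choice[step hstep] : forall kl : nat * seq (M * N), exists l', G kl.2 ->
    [/\ G l', List.incl kl.2 l',
        forall a, cM a = kl.1 -> exists b, List.In (a, b) l' &
        forall b, cN b = kl.1 -> exists a, List.In (a, b) l'].
  case=> k l /=.
  have [gl|ngl] := pselect (G l); last by exists l.
  have [l1 g1 [sub1 h1]] := stepM k l gl; have [l2 g2 [sub2 h2]] := stepN k l1 g1.
  exists l2 => _; split=> //; first by move=> x /sub1/sub2.
  by move=> a /h1[b hb]; exists b; apply: sub2.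
pose L := fix L k := if k is k'.+1 then step (k', L k') else [::].
have GL k : G (L k).
  by elim: k => [|k IH]; [exact: same_type_Th|have [] := hstep (k, L k) IH].
have subL k l : k <= l -> List.incl (L k) (L l).
  elim: l => [|l IH]; first by rewrite leqn0 => /eqP->.
  rewrite leq_eqVlt => /orP[/eqP->//|/IH sub] x /sub.
  by have [_ h _ _] := hstep (l, L l) (GL l); apply: h.
pose R a b := exists k, List.In (a, b) (L k).
have R2 a b c d : R a b -> R c d -> same_type jM jN ZFM ZFN (op ZFM a c) (op ZFN b d).
  move=> [k hk] [l hl]; apply: (matched_pair (GL (maxn k l))).
    exact: (subL _ _ (leq_maxl k l)).
  exact: (subL _ _ (leq_maxr k l)).
have /choice[i hi] : forall a, exists b, R a b.
  move=> a; have [_ _ h _] := hstep (cM a, L (cM a)) (GL _).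
  by have [b hb] := h a erefl; exists b, (cM a).+1.
have /choice[i' hi'] : forall b, exists a, R a b.
  move=> b; have [_ _ _ h] := hstep (cN b, L (cN b)) (GL _).
  by have [a ha] := h b erefl; exists a, (cN b).+1.
exists i; split.
- split; last by move=> x y; apply: same_type_mem s0 (R2 _ _ _ _ (hi x) (hi y)).
  exists i' => [a|b].
    by apply/(same_type_eq s0 (R2 _ _ _ _ (hi' (i a)) (hi a))).
  by apply/(same_type_eq s0 (R2 _ _ _ _ (hi (i' b)) (hi' b))).
- move=> s; by apply/(same_type_param s (R2 _ _ _ _ (hi (jM s)) (hi (jM s)))).
- have [k hk] := hi m0; have E := matched_base_pair (GL k) hk.
  by apply/esym/(same_type_eq s0 E).
Qed.
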